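(* Let $X$ be a represented space. The identity $\mathrm{id}:\mathcal{C}(\mathbb{N},X)'\to\mathcal{C}(\mathbb{N},X')$ is a computable isomorphism. In particular, the limit computable functions $f:\mathbb{N}\to X$ are exactly the functions $f:\mathbb{N}\to X$ that are computable relative to the halting problem.
   Context: A representation of a set $X$ is a surjective partial function $\delta_X:\subseteq\mathbb{N}^{\mathbb{N}}\to X$; $(X,\delta_X)$ is then a represented space. $F:\subseteq\mathbb{N}^{\mathbb{N}}\to\mathbb{N}^{\mathbb{N}}$ is a realizer of $f:X\to Y$, written $F\vdash f$, if $\delta_YF(p)=f\delta_X(p)$ for all $p\in\mathrm{dom}(\delta_X)$. A function between represented spaces is continuous, computable, limit computable, or computable relative to the halting problem if it has a realizer with that property. $\mathcal{C}(X,Y)$ is the set of total continuous functions $f:X\to Y$ in this sense. $f$ is a computable isomorphism if it is bijective and both $f$ and $f^{-1}$ are computable. $\mathbb{N}$ is represented in the standard way, e.g. by $\delta_{\mathbb{N}}(p)=p(0)$. A partial function $F:\subseteq\mathbb{N}^{\mathbb{N}}\to\mathbb{N}^{\mathbb{N}}$ is computable if there is a Turing machine (infinite input tape, one-way output tape) that on each $p\in\mathrm{dom}(F)$ produces $F(p)$ in the long run; it is limit computable if there is a Turing machine with a two-way output tape (it may revise its output) that on each $p\in\mathrm{dom}(F)$ computes $F(p)$ such that each output position $n$ has, after finitely many steps, the content $F(p)(n)$ and is never changed again; it is computable relative to $q\in\mathbb{N}^{\mathbb{N}}$ if there is a computable $G$ with $F(p)=G\langle q,p\rangle$ for all $p\in\mathrm{dom}(F)$.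 Nothing is required outside $\mathrm{dom}(F)$. The halting problem $0'\in\mathbb{N}^{\mathbb{N}}$ is given by $0'(i)=1$ if the $i$-th Turing machine halts on input $000\dots$, and $0'(i)=0$ otherwise. Coding: $\langle n,k\rangle:=\frac12(n+k)(n+k+1)+k$; $\langle p,q\rangle(2n):=p(n)$, $\langle p,q\rangle(2n+1):=q(n)$; $\langle p_0,p_1,\dots\rangle\langle n,k\rangle:=p_n(k)$. Let $\lim:\subseteq\mathbb{N}^{\mathbb{N}}\to\mathbb{N}^{\mathbb{N}}$, $\langle p_0,p_1,\dots\rangle\mapsto\lim_{i\to\infty}p_i$ (product topology). For a represented space $(X,\delta_X)$, $X'$ is the set $X$ with representation $\delta_X\circ\lim$. $q\mapsto\Phi_q$ (defined for all $q\in\mathbb{N}^{\mathbb{N}}$) is a standard representation of the continuous partial functions $\subseteq\mathbb{N}^{\mathbb{N}}\to\mathbb{N}^{\mathbb{N}}$ with $G_\delta$-domain (every continuous partial function on $\mathbb{N}^{\mathbb{N}}$ has an extension $\Phi_q$), satisfying the utm-theorem ($\langle q,p\rangle\mapsto\Phi_q(p)$ is computable) and the smn-theorem (for every computable $F:\subseteq\mathbb{N}^{\mathbb{N}}\to\mathbb{N}^{\mathbb{N}}$ there is a total computable $S$ with $\Phi_{S(q)}(p)=F\langle q,p\rangle$ for all $\langle q,p\rangle\in\mathrm{dom}(F)$). The function space is represented by $\delta_{\mathcal{C}(X,Y)}(p)=f:\iff\Phi_p\vdash f$. *)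

(* Defs.v *)
From HB Require Import structures.
From mathcomp Require Import all_boot all_order all_algebra.
From mathcomp Require Import all_classical all_reals all_analysis.
From mathcomp Require Import borel_hierarchy.

Set Implicit Arguments.
Unset Strict Implicit.
Unset Printing Implicit Defensive.

Import GRing.Theory.

Local Open Scope classical_set_scope.
Local Open Scope nat_scope.

(** * Baire space and codings *)

Definition baire : Type := prod_topology (fun _ : nat => nat).

HB.instance Definition _ := Pointed.on baire.
HB.instance Definition _ := Nbhs.on baire.
HB.instance Definition _ := Topological.on baire.

Definition zeros : baire := fun _ => 0.

Definition cantor_pair (n k : nat) : nat := ((n + k) * (n + k).+1)./2 + k.

Definition bpair (p q : baire) : baire :=
  fun n => if odd n then q n./2 else p n./2.

(* [bcol (<p_0, p_1, ...>) i = p_i] *)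
Definition bcol (p : baire) (i : nat) : baire := fun k => p (cantor_pair i k).

(** * Partial functions: [F p = None] means that [F] is undefined at [p] *)

Definition dom (F : baire -> option baire) : set baire := [set p | isSome (F p)].

(* The default value outside [dom F] is irrelevant: the continuity is that of
   the restriction of [F] to the subspace [dom F]. *)
Definition pcontinuous (F : baire -> option baire) : Prop :=
  {within dom F, continuous (fun p => odflt zeros (F p))}.

Definition blim (p : baire) : option baire :=
  if `[< cvgn (bcol p) >] then Some (limn (bcol p)) else None.

Lemma blimP (p q : baire) : blim p = Some q <-> bcol p @ \oo --> q.
Proof.
have hB : hausdorff_space baire.
  by apply: hausdorff_product => ?; exact: discrete_hausdorff.
rewrite /blim; split; first by case: asboolP => // cp [<-].
by move=> pq; rewrite (cvg_lim hB pq) asboolT.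
Qed.

(** * Turing machines

   A machine has a read-only input tape, an output tape and [k] work tapes,
   all two-way infinite and over the alphabet {blank, 0, 1}; the program is a
   finite table of instructions. *)

Inductive move := Left | Stay | Right.

Definition move_code (d : move) : option bool :=
  match d with Left => Some false | Stay => None | Right => Some true end.
Definition move_decode (o : option bool) : move :=
  match o with Some false => Left | None => Stay | Some true => Right end.
Lemma move_codeK : cancel move_code move_decode. Proof. by case. Qed.
HB.instance Definition _ := Equality.copy move (can_type move_codeK).
HB.instance Definition _ := Choice.copy move (can_type move_codeK).
HB.instance Definition _ := Countable.copy move (can_type move_codeK).

(* [None] is the blank symbol. *)
Definition symbol := option bool.

Record tape := Tape { cells : int -> symbol; head : int }.

Definition read (t : tape) : symbol := cells t (head t).

Definition shift (d : move) (z : int) : int :=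
  match d with Left => z - 1 | Stay => z | Right => z + 1 end%R.

Definition act (a : symbol * move) (t : tape) : tape :=
  Tape (fun z => if z == head t then a.1 else cells t z) (shift a.2 (head t)).

Definition blank_tape : tape := Tape (fun _ => None) 0%R.

(* An instruction [((s, r), ((s', d), w))] applies in state [s] when the symbols
   scanned on the input, the output and the [k] work tapes are [r]; the machine
   then enters state [s'], moves the input head by [d], and writes and moves on
   the output and the work tapes according to [w]. *)
Definition instr (k : nat) : Type :=
  ((nat * (k.+2).-tuple symbol)
   * ((nat * move) * (k.+1).-tuple (symbol * move)))%type.

Definition machine : Type := {k : nat & seq (instr k)}.

HB.instance Definition _ := Countable.on machine.

Record config (k : nat) := Config {
  state : nat;
  input : tape;
  tapes : (k.+1).-tuple tape (* the output tape, then the work tapes *)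
}.

Definition output k (c : config k) : tape := thead (tapes c).

Definition scanned k (c : config k) : (k.+2).-tuple symbol :=
  [tuple of read (input c) :: map read (tapes c)].

(* The first instruction that applies is executed; if there is none, the
   machine halts, and [step] is undefined. *)
Definition step k (prog : seq (instr k)) (c : config k) : option (config k) :=
  omap
    (fun a : (nat * move) * (k.+1).-tuple (symbol * move) =>
       Config a.1.1
         (Tape (cells (input c)) (shift a.1.2 (head (input c))))
         [tuple act (tnth a.2 i) (tnth (tapes c) i) | i < k.+1])
    (ohead [seq e.2 | e <- prog & e.1 == (state c, scanned c)]).

(* A sequence [p] is written on a tape as [1^(p 0) 0 1^(p 1) 0 ...], from cell 0
   on.  As no block is empty, the first [j.+1] blocks determine symbol [j]. *)
Definition unary (p : baire) (j : nat) : bool :=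
  nth false (flatten [seq rcons (nseq (p i) true) false | i <- iota 0 j.+1]) j.

Definition input_tape (p : baire) : tape :=
  Tape (fun z => if z is Posz j then Some (unary p j) else None) 0%R.

Definition init k (p : baire) : config k :=
  Config 0 (input_tape p) [tuple blank_tape | _ < k.+1].

Definition run k (prog : seq (instr k)) (p : baire) (t : nat) : config k :=
  iter t (fun c => odflt c (step prog c)) (init k p).

Definition halts (M : machine) (p : baire) : Prop :=
  exists t, step (tagged M) (run (tagged M) p t) = None.

(* Every output cell reaches its final content after finitely many steps. *)
Definition produces (M : machine) (p q : baire) : Prop :=
  forall j : nat, \forall t \near \oo,
    cells (output (run (tagged M) p t)) (Posz j) = Some (unary q j).

(* The machine leaves an output cell only to the right, and it alters a cell only
   on leaving it; so it never revises its output. *)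
Definition one_way (M : machine) : bool :=
  all (fun e : instr (tag M) =>
         let old := tnth e.1.2 (inord 1) in
         let: (new, d) := thead e.2.2 in
         (d == Right) || (d == Stay) && (new == old))
      (tagged M).

Definition computable (F : baire -> option baire) : Prop :=
  exists2 M : machine, one_way M & forall p q, F p = Some q -> produces M p q.

Definition limit_computable (F : baire -> option baire) : Prop :=
  exists M : machine, forall p q, F p = Some q -> produces M p q.

Definition computable_from (q : baire) (F : baire -> option baire) : Prop :=
  exists2 G, computable G & forall p, dom F p -> F p = G (bpair q p).

(* Numbers that are not the code of a machine stand for the empty program. *)
Definition nth_machine (i : nat) : machine :=
  odflt (Tagged (fun k => seq (instr k)) ([::] : seq (instr 0))) (unpickle i).

Definition halting : baire :=
  fun i => if `[< halts (nth_machine i) zeros >] then 1 else 0.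

(** * Represented spaces *)

Record repspace := RepSpace {
  carrier :> Type;
  rep : baire -> option carrier;
  rep_surj : forall x, exists p, rep p = Some x
}.

Definition realizes (X Y : repspace) (F : baire -> option baire) (f : X -> Y) :=
  forall p x, rep X p = Some x -> obind (rep Y) (F p) = Some (f x).

(* [has_realizer computable f] means that [f] is computable, and so on. *)
Definition has_realizer (P : (baire -> option baire) -> Prop)
    (X Y : repspace) (f : X -> Y) : Prop :=
  exists2 F, P F & realizes F f.

Definition computable_iso (X Y : repspace) (f : X -> Y) : Prop :=
  exists g : Y -> X, [/\ cancel f g, cancel g f,
    has_realizer computable f & has_realizer computable g].

Definition nat_rep (p : baire) : option nat := Some (p 0).

Lemma nat_rep_surj n : exists p, nat_rep p = Some n.
Proof. by exists (fun _ => n). Qed.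

Definition nat_space : repspace := RepSpace nat_rep_surj.

(** ** The jump [X'] *)

Lemma cantor_pair_inj n k n' k' :
  cantor_pair n k = cantor_pair n' k' -> n = n' /\ k = k'.
Proof.
pose T s := (s * s.+1)./2.
have TS s : T s.+1 = T s + s.+1.
  rewrite /T; have -> : s.+1 * s.+2 = s * s.+1 + s.+1.*2.
    by rewrite -muln2 [s * _]mulnC -mulnDr addn2.
  by rewrite halfD odd_double andbF doubleK.
have Tmono s s' : s < s' -> T s + s.+1 <= T s'.
  elim: s' => // s' IH; rewrite ltnS leq_eqVlt => /orP[/eqP ->|/IH le].
    by rewrite TS.
  by rewrite TS (leq_trans le) // leq_addr.
rewrite /cantor_pair -/(T (n + k)) -/(T (n' + k')) => e.
have lt a b c d : a + b < c + d -> T (a + b) + b < T (c + d) + d.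
  move=> /Tmono h; rewrite (@leq_trans (T (a + b) + (a + b).+1)) //.
    by rewrite ltn_add2l ltnS leq_addl.
  by rewrite (leq_trans h) // leq_addr.
have es : n + k = n' + k'.
  by case: (ltngtP (n + k) (n' + k')) => // /lt; rewrite e ltnn.
have ek : k = k' by move: e; rewrite es => /addnI.
by split=> //; move: es; rewrite ek => /addIn.
Qed.

Definition jump_rep (X : repspace) (p : baire) : option X :=
  obind (rep X) (blim p).

Lemma jump_rep_surj (X : repspace) (x : X) : exists p, jump_rep X p = Some x.
Proof.
have [p px] := rep_surj x.
pose P m k := exists n, cantor_pair n k = m.
exists (fun m => if pselect (exists k, P m k) is left e
                 then p (projT1 (cid e)) else 0).
rewrite /jump_rep; set r := (X in blim X).
suff /blimP -> : bcol r @ \oo --> p by [].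
have -> : bcol r = cst p; last exact: cvg_cst.
apply/funext => n; apply/funext => k; rewrite /bcol /r /=.
case: pselect => [e|[]]; last by exists k, n.
by case: cid => k' /= [n'] /cantor_pair_inj[_ ->].
Qed.

Definition jump (X : repspace) : repspace := RepSpace (@jump_rep_surj X).

(** ** Function spaces *)

Record standard (Phi : baire -> baire -> option baire) : Prop := Standard {
  standard_continuous : forall q, pcontinuous (Phi q);
  standard_Gdelta : forall q, Gdelta (dom (Phi q));
  standard_surj : forall F, pcontinuous F -> Gdelta (dom F) ->
    exists q, Phi q = F;
  standard_ext : forall F, pcontinuous F ->
    exists q, forall p, dom F p -> Phi q p = F p;
  standard_utm : exists2 U, computable U &
    forall q p, U (bpair q p) = Phi q p;
  standard_smn : forall F, computable F ->
    exists2 S : baire -> baire, computable (fun q => Some (S q)) &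
      forall q p, dom F (bpair q p) -> Phi (S q) p = F (bpair q p)
}.

Definition C_carrier (X Y : repspace) : Type :=
  {f : X -> Y | has_realizer pcontinuous f}.

Definition C_rep (Phi : baire -> baire -> option baire) (X Y : repspace)
    (p : baire) : option (C_carrier X Y) :=
  if pselect (exists f : C_carrier X Y, realizes (Phi p) (sval f)) is left e
  then Some (projT1 (cid e)) else None.

Lemma C_repP (Phi : baire -> baire -> option baire) (X Y : repspace)
    (p : baire) (f : C_carrier X Y) :
  C_rep Phi X Y p = Some f <-> realizes (Phi p) (sval f).
Proof.
rewrite /C_rep; split.
  by case: pselect => // e [<-]; case: cid.
move=> pf; case: pselect => [e|[]]; last by exists f.
case: cid => g /= pg; congr Some.
have fg : sval g = sval f.
  apply/funext => x; have [r rx] := rep_surj x.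
  by apply: Some_inj; rewrite -(pf r x rx) -(pg r x rx).
case: f g fg {pf pg} => f hf [g hg] /= fg.
by move: hf hg; rewrite fg => hf hg; congr exist; exact: Prop_irrelevance.
Qed.

Lemma C_rep_surj (Phi : baire -> baire -> option baire) (HPhi : standard Phi)
    (X Y : repspace) (f : C_carrier X Y) : exists p, C_rep Phi X Y p = Some f.
Proof.
case: (svalP f) => F cF Ff; have [q qF] := standard_ext HPhi cF.
exists q; apply/C_repP => p x px; rewrite qF; first exact: Ff.
by move: (Ff p x px); rewrite /dom /=; case: (F p).
Qed.

Definition C_space (Phi : baire -> baire -> option baire) (HPhi : standard Phi)
    (X Y : repspace) : repspace := RepSpace (@C_rep_surj Phi HPhi X Y).

(* Main.v *)
(* Let U be a machine that computes the universal function of [Phi].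

   If p = <p_0, p_1, ...> converges to a code q of f, let t_i be what U has written
   after i steps on the input <p_i, s>.  The machine only reads a finite part of
   its input before it writes a given symbol, and it never revises what it has
   written, so t_i converges to Phi_q(s), a name of f(s 0).  The map <p, s> |->
   <t_0, t_1, ...> is total and computable, and the smn-theorem turns it into a map
   from the names in C(N,X)' to those in C(N,X').

   Conversely, let r be a code of f as a function into X', and let t_n be the
   output of U on the name of n, so that f(n) has the name y_n, the limit of the
   columns of t_n.  The columns of t_n that have been written within m steps
   provide an approximation to y = <y_0, y_1, ...> that converges for m to
   infinity.  Applying a computable total S with Phi_{S(y)}(s) = y_{s 0}, again for
   m steps only, yields a sequence that converges to S(y), a code of f.

   For the second statement: a cell of the output tape of a limit machine on the
   name of n is changed after time t iff a certain machine, with (n, t) hard-wired,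
   halts on 000...; so the halting problem finds a time at which the content is
   final.  Conversely, the halting problem is the limit of its approximations in t
   steps, and a machine run for t steps on these converges as before.

   All the functions involved are primitive recursive in their input.  Such
   functions are computed by machines that use their work tapes as counters, and
   the simulation of machines, given by their codes, is itself primitive
   recursive. *)

From HB Require Import structures.
From mathcomp Require Import all_boot all_order all_algebra.
From mathcomp Require Import all_classical all_reals all_analysis.
From mathcomp Require Import zify.
Require Import Defs.

Set Implicit Arguments.
Unset Strict Implicit.
Unset Printing Implicit Defensive.

Import Order.TTheory GRing.Theory Num.Theory.
Local Open Scope nat_scope.

(** * Counter programs on Turing machines *)

(** The abstract state of a counter program: position of the input head, output tape, and registers
    that hold natural numbers. *)
Record store := Store { ih : int; ot : tape; rg : nat -> nat }.

Inductive prim :=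
  | Inc of nat | Dec of nat | MoveIn of move | OutBit of nat | OutLeft.

Inductive test := TReg of bool & nat | TIn of symbol -> bool.

Inductive cmd := Prim of prim | Seq of cmd & cmd | While of test & cmd.

Definition upd (r : nat -> nat) (i v : nat) : nat -> nat :=
  fun j => if j == i then v else r j.

Definition peval (a : prim) (s : store) : store :=
  match a with
  | Inc i => Store (ih s) (ot s) (upd (rg s) i (rg s i).+1)
  | Dec i => Store (ih s) (ot s) (upd (rg s) i (rg s i).-1)
  | MoveIn d => Store (shift d (ih s)) (ot s) (rg s)
  | OutBit i => Store (ih s) (act (Some (rg s i != 0), Right) (ot s)) (rg s)
  | OutLeft => Store (ih s) (act (read (ot s), Left) (ot s)) (rg s)
  end.

Definition teval (p : baire) (t : test) (s : store) : bool :=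
  match t with
  | TReg z i => if z then rg s i == 0 else rg s i != 0
  | TIn f => f (cells (input_tape p) (ih s))
  end.

(* The contents of the output tape satisfy [P] all the time. *)
Inductive exec (p : baire) (P : (int -> symbol) -> Prop) :
    cmd -> store -> store -> Prop :=
  | EPrim a s : P (cells (ot (peval a s))) -> exec p P (Prim a) s (peval a s)
  | ESeq c1 c2 s1 s2 s3 :
      exec p P c1 s1 s2 -> exec p P c2 s2 s3 -> exec p P (Seq c1 c2) s1 s3
  | EExit t c s : ~~ teval p t s -> exec p P (While t c) s s
  | ELoop t c s1 s2 s3 : teval p t s1 ->
      exec p P c s1 s2 -> exec p P (While t c) s2 s3 ->
      exec p P (While t c) s1 s3.

Arguments EPrim {p P a s}.
Arguments EExit {p P t c s}.

Definition regs_prim (a : prim) : nat :=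
  match a with Inc i | Dec i | OutBit i => i.+1 | _ => 0 end.
Definition regs_test (t : test) : nat := if t is TReg _ i then i.+1 else 0.
Fixpoint regs (c : cmd) : nat :=
  match c with
  | Prim a => regs_prim a
  | Seq c1 c2 => maxn (regs c1) (regs c2)
  | While t c => maxn (regs_test t) (regs c)
  end.

Fixpoint one_way_cmd (c : cmd) : bool :=
  match c with
  | Prim a => if a is OutLeft then false else true
  | Seq c1 c2 => one_way_cmd c1 && one_way_cmd c2
  | While _ c => one_way_cmd c
  end.

(* The effect of a machine: the move of the input head, then the actions on the
   output tape (index 0) and on the work tapes (index [i.+1] for register [i]). *)
Definition effect : Type := (move * (nat -> symbol * move))%type.

Definition keep (r : seq symbol) (j : nat) : symbol * move :=
  (nth None r j.+1, Stay).

(** In the list [r] of scanned symbols, index 0 is the input and index 1 the output, so register [i]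
    is found at [i.+2]; there [Some true] is the mark of the number zero. [Dec] stays on the mark,
    which makes it the truncated predecessor. *)
Definition paction (a : prim) (r : seq symbol) : effect :=
  match a with
  | Inc i => (Stay, fun j => (nth None r j.+1, if j == i.+1 then Right else Stay))
  | Dec i => (Stay, fun j => (nth None r j.+1,
      if (j == i.+1) && (nth None r j.+1 != Some true) then Left else Stay))
  | MoveIn d => (d, keep r)
  | OutBit i => (Stay, fun j => if j == 0
      then (Some (nth None r i.+2 != Some true), Right) else keep r j)
  | OutLeft => (Stay, fun j => (nth None r j.+1, if j == 0 then Left else Stay))
  end.

Definition taction (t : test) (r : seq symbol) : bool :=
  match t with
  | TReg z i => let b := nth None r i.+2 == Some true in if z then b else ~~ b
  | TIn f => f (nth None r 0)
  end.

Fixpoint csize (c : cmd) : nat :=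
  match c with
  | Prim _ => 1
  | Seq c1 c2 => csize c1 + csize c2
  | While _ c => (csize c).+1
  end.

(** The command [c] occupies the states from [i] to [i + csize c - 1]; it is entered at [i] and left
    for [e]. A loop has one state of its own, in which the test is decided. *)
Fixpoint trans (c : cmd) (i e q : nat) (r : seq symbol) : nat * effect :=
  match c with
  | Prim a => (e, paction a r)
  | Seq c1 c2 => let m := i + csize c1 in
      if q < m then trans c1 i m q r else trans c2 m e q r
  | While t c => if q == i then (if taction t r then i.+1 else e, (Stay, keep r))
      else trans c i.+1 i q r
  end.

Definition mk_instr (k : nat) (q : nat) (r : (k.+2).-tuple symbol)
    (a : nat * effect) : instr k :=
  ((q, r), ((a.1, a.2.1), [tuple a.2.2 i | i < k.+1])).

Definition program (k : nat) (Q : seq nat)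
    (d : nat -> seq symbol -> nat * effect) : seq (instr k) :=
  [seq mk_instr q r (d q r) | q <- Q, r <- enum {: (k.+2).-tuple symbol}].

Definition do_effect k (c : config k) (a : nat * effect) : config k :=
  Config a.1 (Tape (cells (input c)) (shift a.2.1 (head (input c))))
    [tuple act (a.2.2 i) (tnth (tapes c) i) | i < k.+1].

Lemma step_cons k (e : instr k) prog c :
  step (e :: prog) c = if e.1 == (state c, scanned c) then
    Some (Config e.2.1.1
         (Tape (cells (input c)) (shift e.2.1.2 (head (input c))))
         [tuple act (tnth e.2.2 i) (tnth (tapes c) i) | i < k.+1])
  else step prog c.
Proof. by rewrite /step /=; case: eqP. Qed.

Lemma step_mk_instr k q r a prog (c : config k) :
  step (mk_instr q r a :: prog) c =
  if (q == state c) && (r == scanned c) then Some (do_effect c a)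
  else step prog c.
Proof.
rewrite step_cons /= xpair_eqE; case: andP => // _; congr Some.
by congr Config; apply: eq_from_tnth => i; rewrite !tnth_mktuple.
Qed.

Lemma step_program k Q d (c : config k) :
  step (program k Q d) c =
  if state c \in Q then Some (do_effect c (d (state c) (scanned c))) else None.
Proof.
elim: Q => [//|q Q IH]; rewrite /program /= inE.
have main (s : seq ((k.+2).-tuple symbol)) (prog : seq (instr k)) :
    step ([seq mk_instr q r (d q r) | r <- s] ++ prog) c =
    if (q == state c) && (scanned c \in s)
      then Some (do_effect c (d (state c) (scanned c)))
    else step prog c.
  elim: s => [|r s IHs] /=; first by rewrite andbF.
  rewrite step_mk_instr inE IHs (eq_sym (scanned c)).
  by case: eqP => [->|] //=; case: eqP => [->|].
by rewrite main mem_enum andbT eq_sym; case: eqP => //= _; rewrite -IH.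
Qed.

(** * Correctness of the translation of counter programs into machines *)

Section Adequacy.
Variables (k : nat) (p : baire).

(* A work tape holds a number: cell 0 is marked, and the position of the head is
   the number. *)
Definition ctape (n : nat) : tape :=
  Tape (fun z => if z == 0%R then Some true else None) (Posz n).

Definition embed (q : nat) (s : store) : config k :=
  Config q (Tape (cells (input_tape p)) (ih s))
    [tuple (if nat_of_ord i is j.+1 then ctape (rg s j) else ot s) | i < k.+1].



Lemma scanned_tapes k' (c : config k') (i : 'I_k'.+1) :
  nth None (scanned c) i.+1 = read (tnth (tapes c) i).
Proof.
rewrite [LHS]/= (nth_map blank_tape) ?size_tuple //; congr read.
by rewrite (tnth_nth blank_tape).
Qed.

Lemma scanned_reg q s i : i < k ->
  nth None (scanned (embed q s)) i.+2 = if rg s i == 0 then Some true else None.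
Proof.
move=> ik; rewrite (@scanned_tapes k _ (Ordinal (ik : i.+1 < k.+1))) tnth_mktuple /=.
by rewrite /read /=.
Qed.

Lemma scanned_zero q s i : i < k ->
  (nth None (scanned (embed q s)) i.+2 == Some true) = (rg s i == 0).
Proof. by move=> ik; rewrite scanned_reg //; case: (rg s i == 0). Qed.

Lemma act_read d t : act (read t, d) t = Tape (cells t) (shift d (head t)).
Proof.
by congr Tape; apply/funext => z; case: eqP => [->|].
Qed.

Lemma tapeE t : t = Tape (cells t) (head t).
Proof. by case: t. Qed.

Lemma do_paction q q' a s : regs_prim a <= k ->
  do_effect (embed q s) (q', paction a (scanned (embed q s))) =
  embed q' (peval a s).
Proof.
move=> ak; rewrite /do_effect /embed.
congr Config; first by case: a ak.
apply: eq_from_tnth => i; rewrite !tnth_mktuple.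
have zeroP j : j < k ->
    (nth None (scanned (embed q s)) j.+2 == Some true) = (rg s j == 0).
  exact: scanned_zero.
have readP : nth None (scanned (embed q s)) i.+1 =
    read (tnth (tapes (embed q s)) i) by exact: scanned_tapes.
rewrite [in tnth (tapes _)]/embed tnth_mktuple in readP *.
move: zeroP readP; rewrite -/(embed q s).
move: (tval (scanned (embed q s))) => r zeroP.
case: i => [[|i] ik] /= readP.
  case: a ak => [j|j|d|j|] /= ak; rewrite ?andFb /keep ?readP ?act_read -?tapeE //.
  by rewrite zeroP.
have {}readP : nth None r i.+2 = read (ctape (rg s i)) by [].
case: a ak => [j|j|d|j|] /= ak; rewrite ?eqSS.
- rewrite readP act_read /= /upd.
  by case: eqP => [->|_] //=; congr Tape; rewrite /shift intS addrC.
- case: (eqVneq i j) readP => [->|ij] readP; rewrite /= /upd ?eqxx ?(negPf ij).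
    rewrite zeroP // readP act_read /=; congr Tape.
    by case: (rg s j) => [|n] //=; rewrite /shift; lia.
  by rewrite readP act_read -tapeE.
- by rewrite /keep readP act_read -tapeE.
- by rewrite /keep readP act_read -tapeE.
- by rewrite readP act_read -tapeE.
Qed.

Lemma do_keep q q' s :
  do_effect (embed q s) (q', (Stay, keep (scanned (embed q s)))) = embed q' s.
Proof.
rewrite /do_effect /embed; congr Config.
apply: eq_from_tnth => i; rewrite tnth_mktuple [RHS]tnth_mktuple.
transitivity (act (keep (scanned (embed q s)) i) (tnth (tapes (embed q s)) i)).
  by [].
have -> : keep (scanned (embed q s)) i = (read (tnth (tapes (embed q s)) i), Stay).
  by rewrite /keep scanned_tapes.
by rewrite act_read -tapeE tnth_mktuple.
Qed.

(** Every step counted here is really executed, so a long chain also witnesses that the machine has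
    not halted; [P] is required of the output after each of the steps. *)
Inductive steps (prog : seq (instr k)) (P : (int -> symbol) -> Prop) :
    nat -> config k -> config k -> Prop :=
  | Steps0 c : steps prog P 0 c c
  | StepsS n c c1 c2 : step prog c = Some c1 -> P (cells (output c1)) ->
      steps prog P n c1 c2 -> steps prog P n.+1 c c2.

Lemma steps_trans prog P m n c1 c2 c3 :
  steps prog P m c1 c2 -> steps prog P n c2 c3 -> steps prog P (m + n) c1 c3.
Proof.
by elim=> // {m c1 c2} m c1 c2 c4 s1 Pc _ IH /IH; rewrite addSn; apply: StepsS.
Qed.

Lemma output_embed q s : output (embed q s) = ot s.
Proof. by rewrite /output /thead tnth_mktuple. Qed.

Lemma taction_embed t q s : regs_test t <= k ->
  taction t (scanned (embed q s)) = teval p t s.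
Proof. by case: t => [z i|f] //= ik; rewrite scanned_zero. Qed.

(** Induction on the execution. The program is only required to follow [trans] on the states of [c],
    so the induction hypotheses apply to subcommands, and the lemma applies to a part of a larger
    program. *)
Lemma exec_steps prog P c i e s s' : regs c <= k ->
  (forall q cf, i <= q < i + csize c -> state cf = q ->
     step prog cf = Some (do_effect cf (trans c i e q (scanned cf)))) ->
  P (cells (ot s)) -> exec p P c s s' ->
  P (cells (ot s')) /\
  exists n, steps prog P n (embed i s) (embed e s') /\
            (n = 0 -> False).
Proof.
move=> ck Hd Ps ex; elim: ex i e ck Hd Ps
    => {c s s'} [a s Pa|c1 c2 s1 s2 s3 _ IH1 _ IH2|t c s tf|t c s1 s2 s3 tt _ IH1 _ IH2] i e.
- move=> /= ak Hd Ps; split=> //; exists 1; split=> //.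
  apply: StepsS (Steps0 _ _ _); last by rewrite output_embed.
  by rewrite (Hd i) ?leqnn ?addn1 //= do_paction.
- rewrite /= geq_max => /andP[c1k c2k] Hd P1.
  have [|P2 [n [sn n0]]] := IH1 i (i + csize c1) c1k _ P1.
    move=> q cf /andP[iq qi] Eq; rewrite (Hd q) //; last first.
      by rewrite iq addnA ltn_addr.
    by rewrite /= qi.
  have [|P3 [m [sm m0]]] := IH2 (i + csize c1) e c2k _ P2.
    move=> q cf /andP[iq qi] Eq; rewrite (Hd q) //; last first.
      by rewrite addnA qi andbT (leq_trans _ iq) // leq_addr.
    by rewrite /= ltnNge iq.
  by split=> //; exists (n + m); split; [exact: steps_trans sm | lia].
- rewrite /= geq_max => /andP[tk ck] Hd P1; split=> //; exists 1; split=> //.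
  apply: StepsS (Steps0 _ _ _); last by rewrite output_embed.
  rewrite (Hd i) ?leqnn /= ?addnS ?ltnS ?leq_addr //.
  by rewrite eqxx do_keep taction_embed // (negPf tf).
- rewrite /= geq_max => /andP[tk ck] Hd P1.
  have [|P2 [n [sn n0]]] := IH1 i.+1 i ck _ P1.
    move=> q cf /andP[iq qi] Eq; rewrite (Hd q) //; last by lia.
    by rewrite /= gtn_eqF.
  have [||P3 [m [sm m0]]] := IH2 i e _ _ P2; [by rewrite /= geq_max tk | by [] |].
  split=> //; exists (n + m).+1; split=> //.
  apply: StepsS (steps_trans sn sm); last by rewrite output_embed.
  rewrite (Hd i) ?leqnn /= ?addnS ?ltnS ?leq_addr //.
  by rewrite eqxx do_keep taction_embed // tt.
Qed.

(** A pass starts with the test and therefore takes at least one step; this makes an endless loop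
    run for arbitrarily many steps. *)
Lemma loop_steps prog P t c i e s s' : regs (While t c) <= k ->
  (forall q cf, i <= q < i + csize (While t c) -> state cf = q ->
     step prog cf =
       Some (do_effect cf (trans (While t c) i e q (scanned cf)))) ->
  P (cells (ot s)) -> teval p t s -> exec p P c s s' ->
  P (cells (ot s')) /\
  exists n, steps prog P n.+1 (embed i s) (embed i s').
Proof.
rewrite /= geq_max => /andP[tk ck] Hd P1 ts ex.
have [|P2 [n [sn _]]] := @exec_steps prog P c i.+1 i s s' ck _ P1 ex.
  move=> q cf /andP[iq qi] Eq; rewrite (Hd q) //; last by lia.
  by rewrite /= gtn_eqF.
split=> //; exists n; apply: StepsS sn; last by rewrite output_embed.
rewrite (Hd i) ?leqnn /= ?addnS ?ltnS ?leq_addr //.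
by rewrite eqxx do_keep taction_embed // ts.
Qed.

End Adequacy.

(** * The unary encoding of sequences on tapes *)

Section Unary.
Variable p : baire.

(** The cell in which block [n] of the tape of [p] begins; a block has one cell more than its value,
    for the final zero. *)
Definition pos (n : nat) : nat := \sum_(i < n) (p i).+1.

Definition block (n : nat) : seq bool := rcons (nseq (p n) true) false.
Definition blocks (n : nat) : seq bool := flatten [seq block i | i <- iota 0 n].

Lemma posS n : pos n.+1 = pos n + (p n).+1.
Proof. by rewrite /pos big_ord_recr. Qed.

Lemma blocksS n : blocks n.+1 = blocks n ++ block n.
Proof. by rewrite /blocks -addn1 iotaD map_cat flatten_cat /= cats0. Qed.

Lemma size_blocks n : size (blocks n) = pos n.
Proof.
elim: n => [|n IH]; first by rewrite /pos big_ord0.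
by rewrite blocksS size_cat IH posS size_rcons size_nseq.
Qed.

Lemma leq_pos n : n <= pos n.
Proof. by elim: n => // n IH; rewrite posS; lia. Qed.

Lemma pos_leq m n : m <= n -> pos m <= pos n.
Proof.
elim: n => [|n IH]; first by case: m.
by rewrite leq_eqVlt => /orP[/eqP -> //|/IH h]; rewrite posS (leq_trans h) ?leq_addr.
Qed.

Lemma nth_blocks m n j : m <= n -> j < pos m ->
  nth false (blocks n) j = nth false (blocks m) j.
Proof.
move=> mn jm; rewrite -(subnKC mn); elim: (n - m) => [|d IH]; first by rewrite addn0.
rewrite addnS blocksS nth_cat size_blocks IH ifT //.
by rewrite (leq_trans jm) // pos_leq // leq_addr.
Qed.

Lemma unary_blocks n j : j < pos n -> unary p j = nth false (blocks n) j.
Proof.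
move=> jn; rewrite /unary -/(blocks j.+1).
have h : j < pos j.+1 by exact: leq_pos.
by case: (leqP n j.+1) => [le|/ltnW le]; [rewrite (nth_blocks le) | rewrite -(nth_blocks le)].
Qed.

Lemma unary_pos n m : m <= p n -> unary p (pos n + m) = (m < p n).
Proof.
move=> mn; rewrite (@unary_blocks n.+1) ?posS ?ltn_add2l //.
rewrite blocksS nth_cat size_blocks ltnNge leq_addr /= addKn.
rewrite nth_rcons size_nseq nth_nseq.
by case: ltngtP mn.
Qed.

Lemma pos_split j : exists n m, j = pos n + m /\ m <= p n.
Proof.
elim: j => [|j [n [m [-> mn]]]]; first by exists 0, 0; rewrite /pos big_ord0.
move: mn; rewrite leq_eqVlt => /orP[/eqP ->|mn].
  by exists n.+1, 0; rewrite posS addn0 addnS.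
by exists n, m.+1; rewrite addnS.
Qed.

End Unary.

(** * Terms for primitive recursive functions *)

(** Variables are de Bruijn indices. The step of [Rec] sees the accumulator as variable 0 and the
    loop counter as variable 1; [Orc] asks for a value of the input sequence. *)
Inductive term :=
  | Var of nat | Zero | Succ of term | Let of term & term
  | Drop of nat & term | Rec of term & term & term | Orc of term.

Fixpoint ev (p : baire) (e : seq nat) (t : term) : nat :=
  match t with
  | Var i => nth 0 e i
  | Zero => 0
  | Succ t => (ev p e t).+1
  | Let a b => ev p (ev p e a :: e) b
  | Drop n t => ev p (drop n e) t
  | Rec n b s =>
      iteri (ev p e n) (fun i acc => ev p [:: acc, i & e] s) (ev p e b)
  | Orc t => p (ev p e t)
  end.

Definition nz (i : nat) : test := TReg false i.
Definition clear (i : nat) : cmd := While (nz i) (Prim (Dec i)).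
Definition move_reg (a b : nat) : cmd :=
  Seq (clear b) (While (nz a) (Seq (Prim (Dec a)) (Prim (Inc b)))).
Definition copy_reg (a b tmp : nat) : cmd :=
  Seq (clear b) (Seq (clear tmp) (Seq
    (While (nz a) (Seq (Prim (Dec a)) (Seq (Prim (Inc b)) (Prim (Inc tmp)))))
    (While (nz tmp) (Seq (Prim (Dec tmp)) (Prim (Inc a)))))).

Definition is_one : test := TIn (fun x => x == Some true).
Definition non_blank : test := TIn isSome.

(* The input is written in unary, so the [n]-th value is found by skipping [n]
   blocks of the input tape. *)
Definition query (f : nat) : cmd :=
  Seq (While (nz f) (Seq (Prim (Dec f))
        (Seq (While is_one (Prim (MoveIn Right))) (Prim (MoveIn Right)))))
  (Seq (While is_one (Seq (Prim (Inc f)) (Prim (MoveIn Right))))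
  (Seq (While non_blank (Prim (MoveIn Left))) (Prim (MoveIn Right)))).

(* [compile t r f] puts the value of [t] into register [f], the variables being
   in the registers [r]; it uses only registers from [f] on as scratch. *)
Fixpoint compile (t : term) (r : seq nat) (f : nat) : cmd :=
  match t with
  | Var i => if i < size r then copy_reg (nth 0 r i) f f.+1 else clear f
  | Zero => clear f
  | Succ t => Seq (compile t r f) (Prim (Inc f))
  | Let a b => Seq (compile a r f) (Seq (compile b (f :: r) f.+1) (move_reg f.+1 f))
  | Drop n t => compile t (drop n r) f
  | Rec n b s =>
      Seq (compile n r f) (Seq (compile b r f.+1) (Seq (clear f.+2) (Seq
        (While (nz f) (Seq (Prim (Dec f))
          (Seq (compile s [:: f.+1, f.+2 & r] f.+3)
               (Seq (move_reg f.+3 f.+1) (Prim (Inc f.+2))))))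
        (move_reg f.+1 f))))
  | Orc t => Seq (compile t r f) (query f)
  end.

Lemma one_way_compile t r f : one_way_cmd (compile t r f).
Proof.
elim: t r f => //=.
- by move=> i r f; case: ifP.
- by move=> t IH r f; rewrite IH.
- by move=> a IHa b IHb r f; rewrite IHa IHb.
- by move=> n IHn b IHb s IHs r f; rewrite IHn IHb IHs.
- by move=> t IH r f; rewrite IH.
Qed.

(** * Correctness of the compilation of terms *)

Section CompileCorrect.
Variables (p : baire) (P : (int -> symbol) -> Prop).

Definition runs (c : cmd) (s : store) (r : nat -> nat) : Prop :=
  exists2 s', exec p P c s s' & [/\ ih s' = ih s, ot s' = ot s & rg s' =1 r].

(** The invariant is indexed by the value of the tested register, which each pass lowers by one. *)
Lemma while_ok (Inv : nat -> store -> Prop) (c : cmd) (i n : nat) (s : store) :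
  (forall m s, Inv m s -> rg s i = m) ->
  (forall m s, Inv m.+1 s -> exists2 s', exec p P c s s' & Inv m s') ->
  Inv n s -> exists2 s', exec p P (While (nz i) c) s s' & Inv 0 s'.
Proof.
move=> Hi Hc; elim: n s => [|n IH] s Is.
  exists s => //; apply: EExit; by rewrite /= (Hi _ _ Is).

have [s1 e1 I1] := Hc _ _ Is; have [s2 e2 I2] := IH _ I1.
by exists s2 => //; apply: ELoop e1 e2; rewrite /= (Hi _ _ Is).
Qed.

Lemma clear_ok i s : P (cells (ot s)) -> runs (clear i) s (upd (rg s) i 0).
Proof.
move=> Ps.
pose Inv m s' := [/\ ih s' = ih s, ot s' = ot s & rg s' =1 upd (rg s) i m].
have [||//|s' e I] := @while_ok Inv (Prim (Dec i)) i (rg s i) s.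
- by move=> m s' [_ _ ->]; rewrite /upd eqxx.
- move=> m s' [h1 h2 h3]; exists (peval (Dec i) s'); last split=> //=.
    by apply: EPrim; rewrite /= h2.
  by move=> j; rewrite /upd !h3 /upd eqxx; case: eqP.
- by split=> // j; rewrite /upd; case: eqP => [->|].
by exists s'.
Qed.

Lemma move_reg_ok a b s : a != b -> P (cells (ot s)) ->
  runs (move_reg a b) s (upd (upd (rg s) b (rg s a)) a 0).
Proof.
move=> ab Ps; have [s0 e0 [h1 h2 h3]] := clear_ok b Ps.
pose Inv m s' := [/\ ih s' = ih s, ot s' = ot s, rg s' a = m, 
  rg s' b + m = rg s a & forall j, j != a -> j != b -> rg s' j = rg s j].
have [||//|s' e [i1 i2 i3 i4 i5]] := @while_ok Inv
    (Seq (Prim (Dec a)) (Prim (Inc b))) a (rg s a) s0.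
- by move=> m s' [].
- move=> m s' [i1 i2 i3 i4 i5].
  exists (peval (Inc b) (peval (Dec a) s')).
    by apply: ESeq; apply: EPrim; rewrite /= i2.
  split=> //=; rewrite /upd ?eqxx ?(negPf ab) //.
  + by rewrite i3.
  + by rewrite eq_sym (negPf ab); lia.
  + by move=> j ja jb; rewrite (negPf ja) (negPf jb) i5.
- split=> //.
  + by rewrite h3 /upd (negPf ab).
  + by rewrite h3 /upd eqxx.
  + by move=> j ja jb; rewrite h3 /upd (negPf jb).
exists s'; first exact: ESeq e0 e.
split=> // j; rewrite /upd; case: eqP => [->//|/eqP ja].
by case: eqP => [->|/eqP jb]; [rewrite -i4 addn0 | rewrite i5].
Qed.

Lemma copy_reg_ok a b t s : a != b -> a != t -> b != t -> P (cells (ot s)) ->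
  runs (copy_reg a b t) s (upd (upd (rg s) b (rg s a)) t 0).
Proof.
move=> ab at_ bt Ps; have [s0 e0 [h1 h2 h3]] := clear_ok b Ps.
have [|s1 e1 [k1 k2 k3]] := @clear_ok t s0; first by rewrite h2.
pose Inv m s' := [/\ ih s' = ih s, ot s' = ot s, rg s' a = m, 
  rg s' b + m = rg s a /\ rg s' t + m = rg s a
  & forall j, j != a -> j != b -> j != t -> rg s' j = rg s j].
have [||//|s2 e2 [i1 i2 i3 [i4 i4'] i5]] := @while_ok Inv
    (Seq (Prim (Dec a)) (Seq (Prim (Inc b)) (Prim (Inc t)))) a (rg s a) s1.
- by move=> m s' [].
- move=> m s' [i1 i2 i3 [i4 i4'] i5].
  exists (peval (Inc t) (peval (Inc b) (peval (Dec a) s'))).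
    by do 2?apply: ESeq; apply: EPrim; rewrite /= i2.
  split=> //=; rewrite /upd ?eqxx.
  + by rewrite (negPf at_) (negPf ab) i3.
  + by rewrite (negPf bt) !(eq_sym _ a) (eq_sym t) (negPf ab) (negPf at_) (negPf bt); lia.
  + by move=> j ja jb jt; rewrite (negPf ja) (negPf jb) (negPf jt) i5.
- split=> //.
  + by rewrite k1.
  + by rewrite k2.
  + by rewrite k3 /upd (negPf at_) h3 /upd (negPf ab).
  + by rewrite !k3 /upd eqxx (negPf bt) h3 /upd eqxx.
  + by move=> j ja jb jt; rewrite k3 /upd (negPf jt) h3 /upd (negPf jb).
pose Inv2 m s' := [/\ ih s' = ih s, ot s' = ot s, rg s' t = m, 
  rg s' a + m = rg s a
  & forall j, j != a -> j != t -> rg s' j = rg s2 j].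
have [||//|s3 e3 [j1 j2 j3 j4 j5]] := @while_ok Inv2
    (Seq (Prim (Dec t)) (Prim (Inc a))) t (rg s2 t) s2.
- by move=> m s' [].
- move=> m s' [{}i1 {}i2 {}i3 {}i4 {}i5].
  exists (peval (Inc a) (peval (Dec t) s')).
    by apply: ESeq; apply: EPrim; rewrite /= i2.
  split=> //=; rewrite /upd ?eqxx.
  + by rewrite eq_sym (negPf at_) i3.
  + by rewrite (negPf at_); lia.
  + by move=> j ja jt; rewrite (negPf ja) (negPf jt) i5.
- split=> //; lia.
exists s3; first by apply: ESeq e0 _; apply: ESeq e1 _; apply: ESeq e2 e3.
split=> // j; rewrite /upd; case: eqP => [->//|/eqP jt].
case: eqP => [->|/eqP jb]; first by rewrite j5 // 1?eq_sym // -i4 addn0.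
by case: (eqVneq j a) => [->|ja]; [rewrite -j4 addn0 | rewrite j5 ?i5].
Qed.

Lemma is_one_pos n m s : ih s = Posz (pos p n + m) -> m <= p n ->
  teval p is_one s = (m < p n).
Proof. by move=> h mn; rewrite /is_one /teval h /= unary_pos //; case: (m < p n). Qed.

(** Induction on the number [d] of ones of block [n] that still lie ahead of the head. *)
Lemma skip_ones n d s : d <= p n -> ih s = Posz (pos p n + (p n - d)) ->
  P (cells (ot s)) ->
  exec p P (While is_one (Prim (MoveIn Right))) s
    (Store (Posz (pos p n + p n)) (ot s) (rg s)).
Proof.
elim: d s => [|d IH] s dn hs Ps.
  have -> : Store (Posz (pos p n + p n)) (ot s) (rg s) = s.
    by case: s hs {Ps} => h o r /= ->; rewrite subn0.
  by apply: EExit; rewrite (is_one_pos hs) subn0 ?ltnn.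
apply: (ELoop _ (EPrim _)).
- by rewrite (is_one_pos hs) ?leq_subr //; lia.
- by [].
apply: (IH (Store _ _ _)) => //=; first exact: ltnW.
by rewrite hs; lia.
Qed.

Lemma count_ones f n d s : d <= p n -> ih s = Posz (pos p n + (p n - d)) ->
  P (cells (ot s)) ->
  exists2 r, r =1 upd (rg s) f (rg s f + d) &
  exec p P (While is_one (Seq (Prim (Inc f)) (Prim (MoveIn Right)))) s
    (Store (Posz (pos p n + p n)) (ot s) r).
Proof.
elim: d s => [|d IH] s dn hs Ps.
  exists (rg s); first by move=> j; rewrite /upd addn0; case: eqP => [->|].
  have -> : Store (Posz (pos p n + p n)) (ot s) (rg s) = s.
    by case: s hs {Ps} => h o r /= ->; rewrite subn0.
  by apply: EExit; rewrite (is_one_pos hs) subn0 ?ltnn.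
have [|||r rE er] := IH (peval (MoveIn Right) (peval (Inc f) s)); 
    [exact: ltnW | by rewrite /= hs; lia | by [] |].
exists r.
  by move=> j; rewrite rE /upd /= /upd eqxx addSnnS; case: eqP.
apply: (ELoop _ (ESeq (EPrim _) (EPrim _)) er) => //.
by rewrite (is_one_pos hs) ?leq_subr //; lia.
Qed.

(** The cells to the left of cell 0 are blank, so moving left stops in cell -1, and one move to the
    right reaches cell 0. *)
Lemma rewind_ok n s : ih s = (Posz n - 1)%R -> P (cells (ot s)) ->
  exec p P (Seq (While non_blank (Prim (MoveIn Left))) (Prim (MoveIn Right))) s
    (Store 0%R (ot s) (rg s)).
Proof.
move=> hs Ps.
have h : exec p P (While non_blank (Prim (MoveIn Left))) s
    (Store (-1)%R (ot s) (rg s)).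
  elim: n s hs Ps => [|n IH] s hs Ps.
    have -> : Store (-1)%R (ot s) (rg s) = s by case: s hs {Ps} => h o r /= ->.
    by apply: EExit; rewrite /= hs.
  apply: (ELoop _ (EPrim _)) => //=.
    by rewrite hs (_ : (Posz n.+1 - 1)%R = Posz n) //; lia.
  by apply: (IH (Store _ _ _)) => //=; rewrite hs; lia.
exact: (ESeq h (@EPrim p P (MoveIn Right) (Store (-1)%R (ot s) (rg s)) Ps)).
Qed.

Lemma query_ok f s : ih s = 0%R -> P (cells (ot s)) ->
  runs (query f) s (upd (rg s) f (p (rg s f))).
Proof.
move=> hs Ps; set n := rg s f.
(* After [k] blocks have been skipped, the head is at the start of block [k] and register [f] holds
   the number [m] of blocks still to be skipped. *)
pose Inv m s' := exists k, [/\ k + m = n, ih s' = Posz (pos p k), ot s' = ot s &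
  rg s' =1 upd (rg s) f m].
have [||//|s1 e1 [k [kn h1 h2 h3]]] := @while_ok Inv (Seq (Prim (Dec f))
  (Seq (While is_one (Prim (MoveIn Right))) (Prim (MoveIn Right)))) f n s.
- by move=> m s' [k [_ _ _ ->]]; rewrite /upd eqxx.
- move=> m s' [k [kn h1 h2 h3]].
  set s2 := Store (Posz (pos p k + p k)) (ot (peval (Dec f) s')) (rg (peval (Dec f) s')).
  exists (peval (MoveIn Right) s2).
    apply: (ESeq (EPrim _) (ESeq (skip_ones (leqnn (p k)) _ _) (EPrim _))) => //=;
      by rewrite ?h2 // subnn addn0.
  exists k.+1; split=> //=; rewrite ?posS; try lia.
  by move=> j; rewrite /upd !h3 /upd eqxx; case: eqP.
- exists 0; split=> //; first by rewrite hs /pos big_ord0.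
  by move=> j; rewrite /upd; case: eqP => [->|].
have kE : k = n by lia.
have [|||r rE er] := @count_ones f k (p k) s1; 
  [by [] | by rewrite h1 subnn addn0 | by rewrite h2 |].
exists (Store 0%R (ot s) r).
  apply: (ESeq e1 (ESeq er _)); rewrite -h2.
  apply: (@rewind_ok (pos p k + p k).+1 (Store _ _ _)) => /=; last by rewrite h2.
  by lia.
split=> //= j; rewrite rE /upd !h3 /upd eqxx kE add0n.
by case: eqP.
Qed.

(** Induction on the term. The registers below [f] survive, hence so do the variables while subterms
    are evaluated; the registers from [f] on may have any initial contents, and the input head
    always returns to cell 0. *)
Lemma compile_ok t r f s : all (fun i => i < f) r ->
  ih s = 0%R -> P (cells (ot s)) ->
  exists2 s', exec p P (compile t r f) s s' &
    [/\ ih s' = 0%R, ot s' = ot s, rg s' f = ev p [seq rg s i | i <- r] t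
      & forall i, i < f -> rg s' i = rg s i].
Proof.
elim: t r f s => [i||t IH|a IHa b IHb|n t IH|n IHn b IHb c IHc|t IH] r f s /= rf hs Ps.
- case: ifP => ir.
    have lt : nth 0 r i < f by apply: (all_nthP 0 rf).
    have [||||s' e [h1 h2 h3]] := @copy_reg_ok (nth 0 r i) f f.+1 s;
      rewrite ?ltn_eqF //; first by lia.
    exists s' => //; split; rewrite ?h1 ?h2 //.
      by rewrite h3 /upd ltn_eqF // eqxx (nth_map 0).
    by move=> j jf; rewrite h3 /upd !ltn_eqF //; lia.
  have [s' e [h1 h2 h3]] := clear_ok f Ps; exists s' => //; split; rewrite ?h1 ?h2 //.
    by rewrite h3 /upd eqxx nth_default // size_map leqNgt ir.
  by move=> j jf; rewrite h3 /upd ltn_eqF.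
- have [s' e [h1 h2 h3]] := clear_ok f Ps; exists s' => //; split; rewrite ?h1 ?h2 //.
    by rewrite h3 /upd eqxx.
  by move=> j jf; rewrite h3 /upd ltn_eqF.
- have [s1 e1 [h1 h2 h3 h4]] := IH r f s rf hs Ps.
  exists (peval (Inc f) s1); first by apply: (ESeq e1); apply: EPrim; rewrite /= h2.
  split=> //=; first by rewrite /upd eqxx h3.
  by move=> j jf; rewrite /upd ltn_eqF // h4.
- have [s1 e1 [h1 h2 h3 h4]] := IHa r f s rf hs Ps.
  have [|||s2 e2 [k1 k2 k3 k4]] := IHb (f :: r) f.+1 s1; rewrite ?h2 //.
    by rewrite /= ltnS leqnn; apply: sub_all rf => j /leqW.
  have [||s3 e3 [l1 l2 l3]] := @move_reg_ok f.+1 f s2; rewrite ?k2 ?h2 //.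
    by rewrite gtn_eqF.
  exists s3; first by apply: ESeq e1 _; apply: ESeq e2 e3.
  split; rewrite ?l1 ?l2 ?k2 //.
    rewrite l3 /upd ltn_eqF // eqxx k3 /= h3; congr (ev _ (_ :: _) _).
    by apply/eq_in_map => j jr; rewrite h4 // (allP rf).
  move=> j jf; rewrite l3 /upd !ltn_eqF //; last by lia.
  by rewrite k4 ?h4 //; lia.
- have [|//|//|s1 e1 [h1 h2 h3 h4]] := IH (drop n r) f s.
    by apply/allP => j /mem_drop; apply: (allP rf).
  by exists s1 => //; split=> //; rewrite h3 map_drop.
- have [s1 e1 [h1 h2 h3 h4]] := IHn r f s rf hs Ps.
  have [|||s2 e2 [k1 k2 k3 k4]] := IHb r f.+1 s1; rewrite ?h2 //.
    by apply: sub_all rf => j /leqW.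
  have [|s3 e3 [l1 l2 l3]] := @clear_ok f.+2 s2; first by rewrite k2 h2.
  set e0 := map (rg s) r in h3 *.
  have E1 : map (rg s1) r = e0.
    by apply/eq_in_map => j jr; rewrite h4 // (allP rf).
  set N := ev p e0 n in h3 *.
  pose F j acc := ev p [:: acc, j & e0] c.
  (* After [j] iterations, [f] holds the number of iterations left, [f.+1] the accumulator and
     [f.+2] the loop counter. *)
  pose Inv m s' := exists j, [/\ j + m = N /\ ih s' = 0%R, ot s' = ot s,
    [/\ rg s' f = m, rg s' f.+1 = iteri j F (ev p e0 b) & rg s' f.+2 = j]
    & forall i, i < f -> rg s' i = rg s i].
  have [||//|s4 e4 [j [[jN i1] i2 [i3 i4 i5] i6]]] := @while_ok Inv
      (Seq (Prim (Dec f))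
          (Seq (compile c [:: f.+1, f.+2 & r] f.+3)
               (Seq (move_reg f.+3 f.+1) (Prim (Inc f.+2))))) f N s3.
  + by move=> m s' [j [_ _ []]].
  + move=> m s' [j [[jN i1] i2 [i3 i4 i5] i6]].
    have [|||s5 e5 [m1 m2 m3 m4]] :=
      IHc [:: f.+1, f.+2 & r] f.+3 (peval (Dec f) s'); rewrite /= ?i2 //.
      by rewrite !ltnS leqnn leqnSn; apply: sub_all rf => x; lia.
    have [||s6 e6 [n1 n2 n3]] := @move_reg_ok f.+3 f.+1 s5.
    * by rewrite gtn_eqF.
    * by rewrite m2 /= i2.
    exists (peval (Inc f.+2) s6).
      apply: (ESeq (EPrim _) (ESeq e5 (ESeq e6 (EPrim _)))) => /=; 
      by rewrite ?n2 ?m2 /= ?i2.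
    exists j.+1; split=> /=.
    * by split; [lia | rewrite n1].
    * by rewrite n2 m2.
    * have [ne1 ne2 ne3 ne4 ne5] : [/\ (f == f.+1) = false, (f == f.+2) = false,
          (f == f.+3) = false, (f.+1 == f.+2) = false & (f.+1 == f.+3) = false].
        by split; apply/eqP; lia.
      have [ne6 ne7 ne8] : [/\ (f.+2 == f.+3) = false, (f.+2 == f.+1) = false &
          (f.+1 == f) = false] by split; apply/eqP; lia.
      have ne9 : (f.+2 == f) = false by apply/eqP; lia.
      rewrite /upd !n3 /upd !eqxx ne2 ne4 ne3 ne1 ne5 ne6 ne7.
      rewrite m3 !m4 /=; do ?[lia].
      rewrite /upd /= eqxx ne8 ne9.
      rewrite i3 i4 i5; split=> //.
      rewrite /F; congr (ev _ [:: _, _ & _] _).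
      by apply/eq_in_map => x xr; have := allP rf x xr; move=> xf; rewrite ltn_eqF // i6.
    * move=> x xf; rewrite /upd ltn_eqF; last by lia.
      rewrite n3 /upd !ltn_eqF; do ?[lia].
      by rewrite m4 /= /upd ?ltn_eqF ?i6 //; lia.
  + exists 0; rewrite l1 l2 k1 k2 h2; split=> //.
      rewrite !l3 /upd !eqxx !ltn_eqF; do ?[lia].
      by rewrite k3 E1 k4 // h3.
    move=> x xf; rewrite l3 /upd ltn_eqF; last by lia.
    by rewrite k4 ?h4 //; lia.
  have [||s5 e5 [m1 m2 m3]] := @move_reg_ok f.+1 f s4; rewrite ?i2 //.
    by rewrite gtn_eqF.
  exists s5.
    by apply: ESeq e1 _; apply: ESeq e2 _; apply: ESeq e3 _; apply: ESeq e4 e5.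
  have jE : j = N by lia.
  split; rewrite ?m1 ?m2 //.
    by rewrite m3 /upd ltn_eqF // eqxx i4 jE.
  by move=> x xf; rewrite m3 /upd !ltn_eqF ?i6 //; lia.
- have [s1 e1 [h1 h2 h3 h4]] := IH r f s rf hs Ps.
  have [||s2 e2 [k1 k2 k3]] := @query_ok f s1; rewrite ?h2 //.
  exists s2; first exact: ESeq e1 e2.
  split; rewrite ?k1 ?k2 //; first by rewrite k3 /upd eqxx h3.
  by move=> j jf; rewrite k3 /upd ltn_eqF // h4.
Qed.

End CompileCorrect.

(** * From executions of counter programs to runs of machines *)

Section Runs.
Variables (k : nat) (prog : seq (instr k)).

Definition next (c : config k) : config k := odflt c (step prog c).

Lemma steps_iter P n c c' : steps prog P n c c' -> P (cells (output c)) ->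
  [/\ iter n next c = c',
      forall m, m <= n -> P (cells (output (iter m next c)))
    & forall m, m < n -> step prog (iter m next c) <> None].
Proof.
elim=> {n c c'} [c|n c c1 c2 sc P1 _ IH] Pc.
  by split=> // m; rewrite leqn0 => /eqP ->.
have [E1 E2 E3] := IH P1.
have nc : next c = c1 by rewrite /next sc.
split; first by rewrite iterSr nc.
  by case=> [|m] // mn; rewrite iterSr nc; apply: E2.
case=> [|m] mn; first by rewrite /= sc.
by rewrite iterSr nc; apply: E3.
Qed.

(** The invariant keeps the test true, and each pass takes at least one step, so [n] passes take at
    least [n] steps. *)
Lemma loop_forever p P (Inv : nat -> store -> Prop) t c i e s :
  regs (While t c) <= k ->
  (forall q cf, i <= q < i + csize (While t c) -> state cf = q ->
     step prog cf =
       Some (do_effect cf (trans (While t c) i e q (scanned cf)))) ->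
  (forall n s, Inv n s -> P (cells (ot s))) ->
  (forall n s, Inv n s -> teval p t s /\
     exists2 s', exec p P c s s' & Inv n.+1 s') ->
  Inv 0 s -> forall n, exists m s', [/\ n <= m, Inv n s' &
    steps prog P m (embed k p i s) (embed k p i s')].
Proof.
move=> ck Hd HP Hc I0; elim=> [|n [m [s1 [nm I1 st]]]].
  by exists 0, s; split=> //; apply: Steps0.
have [ts [s2 e2 I2]] := Hc _ _ I1.
have [_ [m' sm']] := loop_steps ck Hd (HP _ _ I1) ts e2.
exists (m + m'.+1), s2; split=> //; last exact: steps_trans sm'.
by rewrite addnS ltnS (leq_trans nm) // leq_addr.
Qed.

End Runs.

Lemma scanned_eq k (c c' : config k) : read (input c) = read (input c') ->
  (forall i, read (tnth (tapes c) i) = read (tnth (tapes c') i)) ->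
  scanned c = scanned c'.
Proof.
move=> Ei Et; apply: val_inj => /=; rewrite Ei; congr (_ :: _).
by apply: (@eq_from_nth _ None); rewrite !size_map !size_tuple // => i ik;
  rewrite !(nth_map blank_tape) ?size_tuple // -!(tnth_nth blank_tape _ (Ordinal ik)).
Qed.

(** Work tapes are blank at first, whereas a counter needs its mark in cell 0. All the marks are
    written in one initial step, which leaves the output tape alone. *)
Definition mark_reg (r : seq symbol) (j : nat) : symbol * move :=
  (if j is 0 then nth None r 1 else Some true, Stay).

Definition mark_effect (q : nat) (r : seq symbol) : nat * effect :=
  (q, (Stay, mark_reg r)).

Definition blank_store : store := Store 0%R blank_tape (fun=> 0).

Lemma do_mark k p q (c := init k p) :
  do_effect c (mark_effect q (scanned c)) = embed k p q blank_store.
Proof.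
have E : nth None (scanned c) 1 = read (tnth (tapes c) ord0).
  exact: (@scanned_tapes k c ord0).
congr Config; apply: eq_from_tnth => -[[|i] ik]; rewrite !tnth_mktuple //=.
by rewrite [X in act (X, _)]E tnth_mktuple act_read -tapeE.
Qed.

(** State 0 writes the marks, and the states from 1 to [csize c] execute [c]. The exit state
    [(csize c).+1] has no instruction, so the machine halts there. *)
Definition machine_of (c : cmd) : machine :=
  Tagged (fun k => seq (instr k)) (program (regs c) (iota 0 (csize c).+1)
    (fun q r => if q == 0 then mark_effect 1 r else trans c 1 (csize c).+1 q r)).

Lemma step_machine_of c cf : step (tagged (machine_of c)) cf =
  if state cf <= csize c then Some (do_effect cf
    (if state cf == 0 then mark_effect 1 (scanned cf)
     else trans c 1 (csize c).+1 (state cf) (scanned cf))) else None.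
Proof. by rewrite [LHS]step_program mem_iota add0n leq0n ltnS. Qed.

Lemma machine_of_step c q cf : 1 <= q < 1 + csize c -> state cf = q ->
  step (tagged (machine_of c)) cf =
    Some (do_effect cf (trans c 1 (csize c).+1 q (scanned cf))).
Proof.
move=> /andP[q1 q2] sq; rewrite step_machine_of sq -ltnS q2.
by rewrite gtn_eqF.
Qed.

Lemma machine_of_init c p : next (tagged (machine_of c)) (init _ p) =
  embed (regs c) p 1 blank_store.
Proof. by rewrite /next step_machine_of; exact: do_mark. Qed.

Lemma run_next (M : machine) p t : run (tagged M) p t = iter t (next (tagged M)) (init _ p).
Proof. by []. Qed.

Lemma thead_tnth T n (s : n.+1.-tuple T) : thead s = tnth s ord0.
Proof. by []. Qed.

Lemma one_way_trans c i e q (r : seq symbol) :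
  one_way_cmd c -> let a := (trans c i e q r).2.2 0 in
  (a.2 == Right) || (a.2 == Stay) && (a.1 == nth None r 1).
Proof.
elim: c i e => [a|c1 IH1 c2 IH2|t c IH] i e /=.
- by case: a => //= *; rewrite ?eqxx.
- by move=> /andP[/IH1 h1 /IH2 h2]; case: ifP.
- by move=> /IH h; case: ifP => //= _; rewrite eqxx.
Qed.

Lemma one_way_machine_of c : one_way_cmd c -> one_way (machine_of c).
Proof.
move=> cw; apply/allP => x /allpairsP[[q r] /= [_ _ ->]].
rewrite !thead_tnth tnth_mktuple /=.
rewrite (tnth_nth None) inordK //=.
case: eqP => _ /=; first by rewrite eqxx.
have := one_way_trans 1 (csize c).+1 q r cw.
by case: ((trans c 1 (csize c).+1 q r).2.2 0).
Qed.

Section InfiniteLoop.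
Variables (p : baire) (Inv : nat -> store -> Prop) (a : prim) (t : test) (c : cmd).
Let main := Seq (Prim a) (While t c).
Let M := machine_of main.
Hypothesis Inv0 : Inv 0 (peval a blank_store).
Hypothesis InvS : forall n s, Inv n s -> teval p t s /\
  exists2 s', exec p (fun=> True) c s s' & Inv n.+1 s'.

(** State 0 writes the marks and state 1 executes [a], so the loop starts in state 2. *)
Lemma loop_step q cf : 2 <= q < 2 + csize (While t c) -> state cf = q ->
  step (tagged M) cf = Some (do_effect cf
    (trans (While t c) 2 (csize main).+1 q (scanned cf))).
Proof.
move=> /andP[q2 q3] sq; rewrite (machine_of_step _ sq) //; last first.
  by rewrite (ltnW q2).
by rewrite /main /= ifF //; lia.
Qed.

Lemma loop_start : run (tagged M) p 2 = embed (regs main) p 2 (peval a blank_store).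
Proof.
rewrite run_next (iterSr 1) machine_of_init; change (iter 1 ?f ?x) with (f x); rewrite /next.
have -> := @machine_of_step main 1 (embed (regs main) p 1 blank_store) isT erefl.
by rewrite /= do_paction // leq_maxl.
Qed.

(** The first [N] passes take finitely many steps, and each later pass maintains [P] in all its
    intermediate steps. This turns a loop invariant into the convergence of an output cell. *)
Lemma loop_stable N (P : (int -> symbol) -> Prop) :
  (forall n s, N <= n -> Inv n s -> P (cells (ot s))) ->
  (forall n s, N <= n -> Inv n s -> exists2 s', exec p P c s s' & Inv n.+1 s') ->
  exists T, forall u, T <= u -> P (cells (output (run (tagged M) p u))).
Proof.
move=> HP HS.
have ck : regs (While t c) <= regs main by rewrite leq_maxr.
have [m0 [s0 [_ I0 st0]]] := @loop_forever _ _ p (fun=> True) Inv t c 2 _ _ ck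
  loop_step (fun _ _ _ => I) InvS Inv0 N.
have [E0 _ _] := steps_iter st0 I.
pose Inv' n := Inv (N + n).
have st n : exists m s', [/\ n <= m, Inv' n s' &
    steps (tagged M) P m (embed (regs main) p 2 s0) (embed (regs main) p 2 s')].
  apply: (@loop_forever _ _ p P Inv' t c 2 _ _ ck loop_step); last first.
  - by rewrite /Inv' addn0.
  - move=> {}n s In; have [ts _] := InvS In; split=> //.
    by rewrite /Inv' addnS; apply: HS In; rewrite leq_addr.
  - by move=> {}n s; apply: HP; rewrite leq_addr.
exists (m0 + 2) => u mu.
have [m [s' [um _ su]]] := st (u - (m0 + 2)).
have [|_ + _] := steps_iter su; first by rewrite output_embed; apply: HP I0.
move=> /(_ _ um); rewrite -E0 -loop_start !run_next -!iterD.
by congr (P (cells (output (iter _ _ _)))); lia.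
Qed.

End InfiniteLoop.

(** * Programs with infinite output *)

Definition try_next (t : term) : cmd := Seq (compile t [:: 1; 0] 3) (Prim (Inc 1)).

(* Register 0 holds an argument [j]; register 3 receives [t (n, j)] for the least
   [n] for which it does not vanish. *)
Definition search (t : term) : cmd :=
  Seq (Seq (clear 1) (clear 3)) (While (TReg true 3) (try_next t)).

Section Search.
Variables (p : baire) (P : (int -> symbol) -> Prop) (t : term).

Lemma try_next_ok m s : ih s = 0%R -> P (cells (ot s)) -> rg s 1 = m ->
  exists2 s', exec p P (try_next t) s s' &
   [/\ ih s' = 0%R, ot s' = ot s, rg s' 3 = ev p [:: m; rg s 0] t,
       rg s' 1 = m.+1 & rg s' 0 = rg s 0 /\ rg s' 2 = rg s 2].
Proof.
move=> hs Ps s1; have [//|//|//|s' e [h1 h2 h3 h4]] := @compile_ok p P t [:: 1; 0] 3 s.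
exists (peval (Inc 1) s'); first by apply: ESeq e (EPrim _); rewrite /= h2.
by split; rewrite //= /upd /= ?h3 ?h4 //= s1.
Qed.

Lemma start_search s : P (cells (ot s)) ->
  exists2 s', exec p P (Seq (clear 1) (clear 3)) s s' &
   [/\ ih s' = ih s, ot s' = ot s, rg s' 3 = 0, rg s' 1 = 0
     & rg s' 0 = rg s 0 /\ rg s' 2 = rg s 2].
Proof.
move=> Ps; have [s1 e1 [h1 h2 h3]] := @clear_ok p P 1 s Ps.
have [|s2 e2 [k1 k2 k3]] := @clear_ok p P 3 s1; first by rewrite h2.
by exists s2; [exact: ESeq e1 e2 | rewrite k1 k2 !k3 /upd /= !h3].
Qed.

Lemma search_loop n m s : ih s = 0%R -> P (cells (ot s)) ->
  rg s 1 = m -> rg s 3 = 0 -> ev p [:: m + n; rg s 0] t != 0 ->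
  (forall i, i < m + n -> ev p [:: i; rg s 0] t = 0) ->
  exists2 s', exec p P (While (TReg true 3) (try_next t)) s s' &
   [/\ ih s' = 0%R, ot s' = ot s, rg s' 3 = ev p [:: m + n; rg s 0] t
     & rg s' 0 = rg s 0 /\ rg s' 2 = rg s 2].
Proof.
elim: n m s => [|n IH] m s hs Ps s1 s3 tn t0.
  have [s' e [h1 h2 h3 h4 h5]] := try_next_ok hs Ps s1.
  exists s'; last by rewrite addn0.
  by apply: ELoop e (EExit _); rewrite /= ?s3 // h3; rewrite addn0 in tn.
have [s' e [h1 h2 h3 h4 [h5 h6]]] := try_next_ok hs Ps s1.
have [||||||s2 e2 [k1 k2 k3 k4]] := IH m.+1 s'; rewrite ?h2 ?h5 ?addSnnS //.
  by rewrite h3 t0 // -addSnnS leq_addr.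
exists s2; first by apply: ELoop e e2; rewrite /= s3.
by rewrite k1 k2 h2 k3 h5 -h6 -[rg s 0]h5 addSnnS.
Qed.

Lemma search_ok n s : ih s = 0%R -> P (cells (ot s)) ->
  ev p [:: n; rg s 0] t != 0 ->
  (forall i, i < n -> ev p [:: i; rg s 0] t = 0) ->
  exists2 s', exec p P (search t) s s' &
   [/\ ih s' = 0%R, ot s' = ot s, rg s' 3 = ev p [:: n; rg s 0] t
     & rg s' 0 = rg s 0 /\ rg s' 2 = rg s 2].
Proof.
move=> hs Ps tn t0; have [s1 e1 [h1 h2 h3 h4 [h5 h6]]] := start_search Ps.
have [||||||s2 e2 [k1 k2 k3 k4]] := @search_loop n 0 s1; rewrite ?h1 ?h2 ?h5 //.
by exists s2; [exact: ESeq e1 e2 | rewrite k1 k2 k3 -h5 -h6].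
Qed.

End Search.

(** Register 0 counts the output cells. The value found is a bit plus one, since zero stands for a
    failed trial; [Dec] recovers the bit. *)
Definition run_bits (t : term) : cmd :=
  Seq (search t) (Seq (Prim (Dec 3)) (Seq (Prim (OutBit 3)) (Prim (Inc 0)))).

Theorem computable_bits (t : term) (F : baire -> option baire) :
  (forall p q, F p = Some q -> forall j, exists n,
     ev p [:: n; j] t = (unary q j).+1 /\
     forall m, m < n -> ev p [:: m; j] t = 0) ->
  computable F.
Proof.
(* Register 2 is set to 1 and is not changed afterwards, which makes the outer loop endless. *)
move=> tF; exists (machine_of (Seq (Prim (Inc 2)) (While (nz 2) (run_bits t)))).
  by apply: one_way_machine_of; rewrite /= one_way_compile.
move=> p q /tF {F}tF j.
pose Inv n s := [/\ ih s = 0%R, rg s 0 = n, rg s 2 = 1, head (ot s) = Posz n &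
   forall j, j < n -> cells (ot s) (Posz j) = Some (unary q j)].
(* A pass changes the output in cell [n] only, so it maintains every [P] that survives this one
   change. The general [P] serves both for non-termination and for the stability of a given cell. *)
have main P n s : Inv n s -> P (cells (ot s)) ->
    P (fun z => if z == Posz n then Some (unary q n) else cells (ot s) z) ->
    exists2 s', exec p P (run_bits t) s s' & Inv n.+1 s'.
  move=> [i1 i2 i3 i4 i5] P1 P2.
  have [m [tm t0]] := tF n.
  have [//|//|||s1 e1 [h1 h2 h3 [h4 h5]]] := @search_ok p P t m s.
  - by rewrite i2 tm.
  - by rewrite i2.
  have E : ot (peval (OutBit 3) (peval (Dec 3) s1)) = 
     Tape (fun z => if z == Posz n then Some (unary q n) else cells (ot s) z) (Posz n.+1).
    rewrite /= /upd /= h3 i2 tm h2 /act i4 /=; congr Tape; last by lia.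
    by case: (unary q n).
  exists (peval (Inc 0) (peval (OutBit 3) (peval (Dec 3) s1))).
    apply: ESeq e1 (ESeq (EPrim _) (ESeq (EPrim _) (EPrim _))).
    - by rewrite /= h2.
    - by rewrite E.
    - by rewrite -/(ot (peval (OutBit 3) (peval (Dec 3) s1))) E.
  split; rewrite -?/(ot (peval (OutBit 3) (peval (Dec 3) s1))) ?E //=.
  - by rewrite /upd /= h4 i2.
  - by rewrite /upd /= h5.
  - move=> i; rewrite ltnS leq_eqVlt => /orP[/eqP -> | ilt]; first by rewrite eqxx.
    by rewrite ifF ?i5 //; apply/eqP; lia.
have Inv0 : Inv 0 (peval (Inc 2) blank_store) by [].
have InvS n s : Inv n s -> teval p (nz 2) s /\
    exists2 s', exec p (fun=> True) (run_bits t) s s' & Inv n.+1 s'.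
  by move=> In; split; [case: In => _ _ /= -> | exact: main].
(* Cell [j] is written in pass [j], and from pass [j.+1] on only cells to its right are changed. *)
have [||T HT] := @loop_stable p Inv _ _ _ Inv0 InvS j.+1
  (fun f => f (Posz j) = Some (unary q j)).
- by move=> n s jn [_ _ _ _]; apply.
- move=> n s jn In; have jq : cells (ot s) (Posz j) = Some (unary q j).
    by case: In => _ _ _ _; apply.
  apply: main => //; rewrite ifF //; apply/eqP; lia.
by exists T => // u /= Tu; apply: HT.
Qed.

Definition rewrite_bit (t : term) : cmd :=
  Seq (Prim (Dec 3))
    (Seq (compile t [:: 0; 1] 4) (Seq (Prim (OutBit 4)) (Prim (Inc 0)))).

(** Stage [n], with [n] in register 1, writes the [n]-th approximations into the cells from 0 to [n]
    and then takes the output head back to cell 0. *)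
Definition run_stage (t : term) : cmd :=
  Seq (clear 0) (Seq (compile (Succ (Var 0)) [:: 1] 3) (Seq
    (While (nz 3) (rewrite_bit t)) (Seq
    (While (nz 0) (Seq (Prim (Dec 0)) (Prim OutLeft))) (Prim (Inc 1))))).

(** Every stage [n >= j] rewrites cell [j], so its content is constant as soon as the approximations
    are. *)
Theorem limit_computable_bits (t : term) (F : baire -> option baire) :
  (forall p q, F p = Some q -> forall j, exists N,
     forall n, N <= n -> (ev p [:: j; n] t != 0) = unary q j) ->
  limit_computable F.
Proof.
move=> tF; exists (machine_of (Seq (Prim (Inc 2)) (While (nz 2) (run_stage t)))).
move=> p q /tF {F}tF j.
pose b n j := Some (ev p [:: j; n] t != 0).
(* Before stage [n] the cells below [n] show the approximations of the preceding stage; for [n = 0]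
   there are no such cells. *)
pose Inv n s := [/\ ih s = 0%R, rg s 1 = n, rg s 2 = 1, head (ot s) = 0%R &
   forall j, j < n -> cells (ot s) (Posz j) = b n.-1 j].
have main (P : (int -> symbol) -> Prop) n s : Inv n s -> P (cells (ot s)) ->
    (forall f i, P f -> P (fun z => if z == Posz i then b n i else f z)) ->
    exists2 s', exec p P (run_stage t) s s' & Inv n.+1 s'.
  move=> [i1 i2 i3 i4 i5] P1 P2.
  have [s1 e1 [h1 h2 h3]] := @clear_ok p P 0 s P1.
  have [|||s2 e2 [k1 k2 k3 k4]] := @compile_ok p P (Succ (Var 0)) [:: 1] 3 s1;
    rewrite ?h1 ?h2 //.
  pose Inv1 m s' := exists i, [/\ i + m = n.+1, ih s' = 0%R, head (ot s') = Posz i,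
     (forall j, j < i -> cells (ot s') (Posz j) = b n j) &
     [/\ rg s' 0 = i, rg s' 1 = n, rg s' 2 = 1, rg s' 3 = m & P (cells (ot s'))]].
  have [|||s3 e3 [i [I1 I2 I3 I4 [J0 J1 J2 J3 J4]]]] :=
     @while_ok p P Inv1 (rewrite_bit t) 3 n.+1 s2.
  - by move=> m s' [i [_ _ _ _ []]].
  - move=> m s' [i [I1 I2 I3 I4 [J0 J1 J2 J3 J4]]].
    have [|||s4 e4 [l1 l2 l3 l4]] := @compile_ok p P t [:: 0; 1] 4 (peval (Dec 3) s'); 
      rewrite //=.
    have E : ot (peval (OutBit 4) s4) = 
        Tape (fun z => if z == Posz i then b n i else cells (ot s') z) (Posz i.+1).
      rewrite /= l2 /act /= I3; congr Tape; last by lia.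
      by rewrite l3 /= /upd /= J0 J1.
    have PE : P (cells (ot (peval (OutBit 4) s4))) by rewrite E; apply: P2.
    exists (peval (Inc 0) (peval (OutBit 4) s4)).
      apply: (ESeq (EPrim _) (ESeq e4 (ESeq (EPrim _) (EPrim _)))); [exact: J4|exact: PE|exact: PE].
    exists i.+1; split=> //; change (ot (peval (Inc 0) ?x)) with (ot x);
      rewrite ?E //=; first by lia.
    + move=> j'; rewrite ltnS leq_eqVlt => /orP[/eqP ->|ji]; first by rewrite eqxx.
      by rewrite ifF ?I4 //; apply/eqP; lia.
    + by split; last exact: P2; rewrite /= /upd /= ?l4 //= /upd /= ?J0 ?J3.
  - exists 0; split; rewrite ?k1 ?k2 ?h2 //.
    by rewrite k3 !k4 //= !h3 /upd /= !i2 i3.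
  pose Inv2 m s' := [/\ ih s' = 0%R, head (ot s') = Posz m,
     cells (ot s') = cells (ot s3) & [/\ rg s' 0 = m, rg s' 1 = n & rg s' 2 = 1]].
  have [||//|s4 e4 [l1 l2 l3 [l4 l5 l6]]] :=
     @while_ok p P Inv2 (Seq (Prim (Dec 0)) (Prim OutLeft)) 0 i s3.
  - by move=> m s' [_ _ _ []].
  - move=> m s' [l1 l2 l3 [l4 l5 l6]].
    have E : ot (peval OutLeft (peval (Dec 0) s')) = 
        Tape (cells (ot s3)) (Posz m).
      by rewrite /= act_read l3 l2; congr Tape; rewrite /shift; lia.
    exists (peval OutLeft (peval (Dec 0) s')).
      by apply: ESeq (EPrim _) (EPrim _); rewrite ?E //= l3.
    by split; rewrite ?E //= /upd /= l4.
  exists (peval (Inc 1) s4).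
    apply: ESeq e1 (ESeq e2 (ESeq e3 (ESeq e4 (EPrim _)))).
    by rewrite /= l3.
  split=> //=; rewrite /upd /= ?l5 // l3 => j' jn; apply: I4.
  by rewrite addn0 in I1; rewrite I1.
have Inv0 : Inv 0 (peval (Inc 2) blank_store) by [].
have InvS n s : Inv n s -> teval p (nz 2) s /\
    exists2 s', exec p (fun=> True) (run_stage t) s s' & Inv n.+1 s'.
  by move=> In; split; [case: In => _ _ /= -> | exact: main].
have [N HN] := tF j.
(* From this stage on cell [j] has its final content, and rewriting it puts the same symbol
   there. *)
have [||T HT] := @loop_stable p Inv _ _ _ Inv0 InvS (maxn j N).+1
  (fun f => f (Posz j) = Some (unary q j)).
- move=> [//|n] s; rewrite ltnS geq_max => /andP[jn Nn] [_ _ _ _ ->] //=.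
  by rewrite /b HN.
- move=> n s jn In; have jq : cells (ot s) (Posz j) = Some (unary q j).
    case: n In jn => [//|n] [_ _ _ _ H]; rewrite ltnS geq_max => /andP[jn Nn].
    by rewrite H //= /b HN.
  apply: main => // f i Pf; case: eqP => // -[<-]; rewrite /b HN //.
  by move: jn; lia.
by exists T => // u /= Tu; apply: HT.
Qed.

(** * Machines with a hard-wired parameter *)

Section ParamMachine.
Variable t : term.
Let c := search t.
Let k := regs c.
Let base := (csize c).+2.

Definition param_store (m : nat) : store :=
  Store 0%R blank_tape (upd (fun=> 0) 0 m).

(** Register 0 starts with 1: its head is off the mark, so all the instructions that load the
    parameter scan the same tuple [scan_param], and one instruction per state suffices. The search
    therefore receives [m.+1] for the parameter [m]. *)
Definition param_mark (q : nat) (r : seq symbol) : nat * effect :=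
  (q, (Stay, fun j => (if j is 0 then nth None r 1 else Some true,
                       if j == 1 then Right else Stay))).

Definition scan_init : (k.+2).-tuple symbol := scanned (init k zeros).
Definition scan_param : (k.+2).-tuple symbol :=
  scanned (embed k zeros 0 (param_store 1)).

(** The exit state [(csize c).+1] of the search is left without instruction, so the machine halts
    there; [base] is the next number and serves to enter the search after loading. *)
Definition search_program : seq (instr k) :=
  program k (rcons (iota 1 (csize c)) base) (fun q r =>
    if q == base then (1, (Stay, keep r)) else trans c 1 (csize c).+1 q r).

Definition load_param (m : nat) : seq (instr k) :=
  iteri m (fun i prog =>
    mk_instr (base + i).+1 scan_param (base + i, paction (Inc 0) scan_param)
      :: prog) search_program.

(* The smn-theorem: the parameter [m] is hard-wired by [m] instructions, which
   increment register 0. *)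
Definition param_machine (m : nat) : machine :=
  Tagged (fun k => seq (instr k))
    (mk_instr 0 scan_init (param_mark (base + m) scan_init) :: load_param m).

Lemma k_gt0 : 0 < k.
Proof. by rewrite /k /c /=; lia. Qed.

Lemma scan_paramE q m : scanned (embed k zeros q (param_store m.+1)) = scan_param.
Proof.
apply: scanned_eq => // i; rewrite !tnth_mktuple.
by case: i => [[|[|i]] ik].
Qed.

Lemma load_param_miss m cf : state cf <= base ->
  step (load_param m) cf = step search_program cf.
Proof.
move=> sb; elim: m => //= m IH; rewrite [LHS]step_mk_instr IH.
by rewrite gtn_eqF // ltnS (leq_trans sb) // leq_addr.
Qed.

Lemma load_param_hit m i cf : i < m -> state cf = (base + i).+1 ->
  scanned cf = scan_param ->
  step (load_param m) cf = Some (do_effect cf (base + i, paction (Inc 0) scan_param)).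
Proof.
elim: m => // m IH im si sc; rewrite [LHS]step_mk_instr sc eqxx andbT si.
rewrite eqSS eqn_add2l; move: im; rewrite ltnS leq_eqVlt.
by case: eqP => [-> _|/eqP mi /= im]; rewrite ?eqxx // eq_sym (negPf mi) IH.
Qed.

Lemma param_step m cf : 0 < state cf ->
  step (tagged (param_machine m)) cf = step (load_param m) cf.
Proof. by move=> s0; rewrite [LHS]step_mk_instr ltn_eqF. Qed.

Lemma search_program_step q cf : 1 <= q < 1 + csize c -> state cf = q ->
  step search_program cf =
    Some (do_effect cf (trans c 1 (csize c).+1 q (scanned cf))).
Proof.
move=> q1 sq; rewrite step_program mem_rcons inE mem_iota sq q1 orbT.
by rewrite ifF //; apply/eqP; rewrite /base; lia.
Qed.

Lemma param_trans m q cf : 1 <= q < 1 + csize c -> state cf = q ->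
  step (tagged (param_machine m)) cf =
    Some (do_effect cf (trans c 1 (csize c).+1 q (scanned cf))).
Proof.
move=> q1 sq; rewrite param_step ?sq ?load_param_miss ?sq //.
- exact: search_program_step.
- by rewrite /base; lia.
- by case/andP: q1.
Qed.

Let run_param (m n : nat) (x y : config k) : Prop :=
  steps (tagged (param_machine m)) (fun=> True) n x y.

Lemma param_load m i d : i + d = m ->
  run_param m d (embed k zeros (base + m) (param_store 1))
    (embed k zeros (base + i) (param_store d.+1)).
Proof.
elim: d i => [|d IH] i idm.
  by rewrite addn0 in idm; rewrite idm; exact: Steps0.
rewrite /run_param -addn1; apply: steps_trans (IH i.+1 _) _; first by lia.
apply: StepsS (Steps0 _ _ _) => //.
rewrite param_step //= addnS (@load_param_hit _ i) //; first last.
- exact: scan_paramE.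
- by lia.
rewrite -(scan_paramE (base + i).+1 d) do_paction ?k_gt0 //.
congr (Some (embed _ _ _ (Store _ _ _))).
by apply/funext => j; rewrite /= /upd ?eqxx addn1; case: (j == 0).
Qed.

(** One step writes the marks, [m] steps increment register 0, and one step leads from [base] to the
    search. *)
Lemma param_start m : run_param m m.+2 (init k zeros)
  (embed k zeros 1 (param_store m.+1)).
Proof.
apply: (@StepsS _ _ _ _ _ (embed k zeros (base + m) (param_store 1))) => //.
  rewrite [LHS]step_mk_instr !eqxx /=; congr Some.
  congr Config; apply: eq_from_tnth => -[[|[|j]] jk]; rewrite !tnth_mktuple //=.
  have E : nth None scan_init 1 = read (tnth (tapes (init k zeros)) ord0).
    exact: (@scanned_tapes k (init k zeros) ord0).
  by rewrite [X in act (X, _)]E tnth_mktuple act_read -tapeE.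
rewrite -addn1; apply: steps_trans (@param_load m 0 m (add0n m)) _.
apply: StepsS (Steps0 _ _ _) => //; rewrite addn0.
rewrite param_step // load_param_miss // step_program.
rewrite (_ : state _ = base) // mem_rcons mem_head eqxx.
by rewrite do_keep addn1.
Qed.

(** If some value is non-zero, the search stops at the least such argument and reaches a state
    without instruction. Otherwise its loop executes arbitrarily many steps, so no configuration is
    a halting one. *)
Lemma halts_param m :
  halts (param_machine m) zeros <-> exists n, ev zeros [:: n; m.+1] t != 0.
Proof.
have [E1 _ E3] := steps_iter (param_start m) I.
split; last first.
  move=> ex; have [n tn minn] := ex_minnP ex.
  have [||||s e _] := @search_ok zeros (fun=> True) t n (param_store m.+1).
  - by [].
  - by [].
  - exact: tn.
  - by move=> i /= im; apply/eqP; apply: contraTT im => /minn; rewrite -leqNgt.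
  have [_ [N [sN _]]] := exec_steps (leqnn _) (@param_trans m) I e.
  have [E4 _ _] := steps_iter (steps_trans (param_start m) sN) I.
  exists (m.+2 + N); rewrite run_next E4 param_step // load_param_miss //.
  rewrite step_program (_ : state _ = (csize c).+1) // mem_rcons inE mem_iota.
  by rewrite ltnn andbF orbF ltn_eqF.
case=> u hu; apply: contrapT => /forallNP no.
have t0 n : ev zeros [:: n; m.+1] t = 0.
  by apply/eqP; apply: contra_notT (no n).
have [s0 e0 [h1 h2 h3 h4 [h5 h6]]] :=
  @start_search zeros (fun=> True) (param_store m.+1) I.
pose Inv n s := [/\ ih s = 0%R, rg s 0 = m.+1, rg s 3 = 0 & rg s 1 = n].
(* The two [clear] commands occupy the states from 1 to 4, so the loop of the search starts in state
   5. *)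
have [||_ [N [sN _]]] := @exec_steps k zeros (tagged (param_machine m))
    (fun=> True) _ 1 5 _ _ _ _ I e0.
- by rewrite /k /c leq_maxl.
- move=> q cf /andP[q1 q5] sq; rewrite (@param_trans m q) //.
    by rewrite /c /= q5.
  by rewrite q1 /= (leq_trans q5) // leq_add2l leq_addr.
have loop : forall n, exists M s', [/\ n <= M, Inv n s' &
    run_param m M (embed k zeros 5 s0) (embed k zeros 5 s')].
  apply: (@loop_forever k _ zeros (fun=> True) Inv (TReg true 3) (try_next t) 5
            (csize c).+1 s0) => //.
  - by rewrite /k /c leq_maxr.
  - move=> q cf /andP[q5 q2] sq; rewrite (@param_trans m q) //.
      by rewrite /c /= ifF //; lia.
    by rewrite /c /= in q2 *; lia.
  - move=> n s [i1 i2 i3 i4]; split; first by rewrite /= i3.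
    have [//|s' e [l1 l2 l3 l4 [l5 l6]]] := @try_next_ok zeros (fun=> True) t n s i1 _ i4.
    exists s'; first exact: e.
    rewrite /Inv l1 l3 l4 l5 i2 t0.
    by [].
have [M [s1 [uM _ sM]]] := loop u.
have [_ _ H] := steps_iter (steps_trans (param_start m) (steps_trans sN sM)) I.
by apply: (H u); [lia | exact: hu].
Qed.

End ParamMachine.

(** * Primitive recursive functions on codes *)

(* Primitive recursive functions of a sequence of numbers and an oracle. *)
Definition df (f : baire -> seq nat -> nat) : Prop :=
  exists t, forall p e, ev p e t = f p e.

Lemma df_ext f g : df f -> (forall p e, f p e = g p e) -> df g.
Proof. by move=> [t tf] fg; exists t => p e; rewrite tf. Qed.

Lemma df_var i : df (fun _ e => nth 0 e i).
Proof. by exists (Var i). Qed.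

Lemma df_succ f : df f -> df (fun p e => (f p e).+1).
Proof. by case=> t tf; exists (Succ t) => p e /=; rewrite tf. Qed.

Lemma df_const n : df (fun _ _ => n).
Proof. by elim: n => [|n]; [exists Zero | exact: df_succ]. Qed.

Lemma df_orc f : df f -> df (fun p e => p (f p e)).
Proof. by case=> t tf; exists (Orc t) => p e /=; rewrite tf. Qed.

Lemma df_drop n f : df f -> df (fun p e => f p (drop n e)).
Proof. by case=> t tf; exists (Drop n t) => p e /=; rewrite tf. Qed.

Lemma df_let a b : df a -> df b -> df (fun p e => b p (a p e :: e)).
Proof. by move=> [t ta] [u ub]; exists (Let t u) => p e /=; rewrite ub ta. Qed.

Lemma df_iteri n b s : df n -> df b -> df s ->
  df (fun p e => iteri (n p e) (fun i acc => s p [:: acc, i & e]) (b p e)).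
Proof.
move=> [tn Hn] [tb Hb] [ts Hs]; exists (Rec tn tb ts) => p e /=.
by rewrite Hn Hb; elim: (n p e) => //= k ->; rewrite Hs.
Qed.

Definition prn (g : baire -> nat -> nat) : Prop :=
  df (fun p e => g p (nth 0 e 0)).

Lemma df_comp1 g u : prn g -> df u -> df (fun p e => g p (u p e)).
Proof. by move=> hg hu; apply: (df_let hu hg). Qed.

Definition fn2 (g : nat -> nat -> nat) : Prop :=
  df (fun _ e => g (nth 0 e 0) (nth 0 e 1)).

Lemma df_comp2 g u v : fn2 g -> df u -> df v -> df (fun p e => g (u p e) (v p e)).
Proof.
move=> hg hu hv; apply: df_ext (df_let hv (df_let (df_drop 1 hu) hg)) _.
by move=> p e /=; rewrite drop0.
Qed.

(** The step of the recursion ignores the accumulator, so every positive number of iterations gives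
    the value of [a]. *)
Lemma df_if c a b : df c -> df a -> df b ->
  df (fun p e => if c p e != 0 then a p e else b p e).
Proof.
move=> hc ha hb; apply: df_ext (df_iteri hc hb (df_drop 2 ha)) _ => p e.
by case: (c p e) => //= n; rewrite drop0.
Qed.

Lemma fn2_add : fn2 addn.
Proof.
apply: df_ext (df_iteri (df_var 0) (df_var 1) (df_succ (df_var 0))) _ => p e.
by elim: (nth 0 e 0) => //= n ->.
Qed.

Lemma prn_pred : prn (fun _ n => n.-1).
Proof.
apply: df_ext (df_iteri (df_var 0) (df_const 0) (df_var 1)) _ => p e.
by case: (nth 0 e 0).
Qed.

Lemma fn2_sub : fn2 subn.
Proof.
apply: df_ext (df_iteri (df_var 1) (df_var 0) (df_comp1 prn_pred (df_var 0))) _ => p e.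
by elim: (nth 0 e 1) => [|n IH]; rewrite ?subn0 //= IH subnS.
Qed.

Lemma prn_odd : prn (fun _ n => odd n).
Proof.
apply: df_ext (df_iteri (df_var 0) (df_const 0)
  (df_if (df_var 0) (df_const 0) (df_const 1))) _ => p e.
by elim: (nth 0 e 0) => //= n ->; case: (odd n).
Qed.

Lemma prn_half : prn (fun _ n => n./2).
Proof.
apply: df_ext (df_iteri (df_var 0) (df_const 0)
  (df_comp2 fn2_add (df_comp1 prn_odd (df_var 1)) (df_var 0))) _ => p e.
by elim: (nth 0 e 0) => //= n ->; rewrite uphalf_half.
Qed.

Lemma fn2_mul : fn2 muln.
Proof.
apply: df_ext (df_iteri (df_var 0) (df_const 0)
  (df_comp2 fn2_add (df_var 3) (df_var 0))) _ => p e.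
by elim: (nth 0 e 0) => //= n ->; rewrite mulSn.
Qed.

(* [consc], [headc] and [tailc] are [cons], [head] and [behead] on the codes of
   [CodeSeq]: [headc] counts the factors 2 of a number, by halving it as long as
   it is even. *)
Definition consc (x s : nat) : nat := 2 ^ x * s.*2.+1.

Definition halve (n i : nat) : nat :=
  iteri i (fun _ m => if odd m then m else m./2) n.

Definition headc (n : nat) : nat :=
  iteri n (fun i acc => acc + ~~ odd (halve n i)) 0.

Definition tailc (n : nat) : nat := (halve n n)./2.

Lemma odd_consc x s : odd (consc x s) = (x == 0).
Proof. by rewrite /consc oddM oddX [odd _.*2.+1]oddS odd_double orbF andbT. Qed.

Lemma half_consc x s : (consc x.+1 s)./2 = consc x s.
Proof. by rewrite /consc expnS -mulnA mul2n doubleK. Qed.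

Lemma half_consc0 s : (consc 0 s)./2 = s.
Proof. by rewrite /consc mul1n /= uphalf_double. Qed.

Lemma leq_consc x s : x <= consc x s.
Proof. by rewrite /consc (leq_trans (ltnW (ltn_expl x (ltnSn 1)))) // leq_pmulr. Qed.

Lemma halve_consc x s i : halve (consc x s) i = consc (x - i) s.
Proof.
elim: i => [|i IH]; first by rewrite subn0.
rewrite /halve /= -/(halve _ i) IH subnS odd_consc.
by case: (x - i) => [|y] //; rewrite half_consc.
Qed.

Lemma headc_consc x s : headc (consc x s) = x.
Proof.
have main n : iteri n (fun i acc => acc + ~~ odd (halve (consc x s) i)) 0 = minn x n.
  elim: n => [|n IH]; first by rewrite minn0.
  by rewrite /= IH halve_consc odd_consc subn_eq0; lia.
by rewrite /headc main; apply/minn_idPl/leq_consc.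
Qed.

Lemma tailc_consc x s : tailc (consc x s) = s.
Proof.
by rewrite /tailc halve_consc (eqP (leq_consc x s)) half_consc0.
Qed.

Lemma fn2_consc : fn2 consc.
Proof.
have two : df (fun _ e => 2 ^ nth 0 e 0).
  apply: df_ext (df_iteri (df_var 0) (df_const 1)
    (df_comp2 fn2_add (df_var 0) (df_var 0))) _ => p e.
  by elim: (nth 0 e 0) => //= n ->; rewrite addnn expnS mul2n.
apply: df_ext (df_comp2 fn2_mul two
  (df_succ (df_comp2 fn2_add (df_var 1) (df_var 1)))) _ => p e.
by rewrite /consc -addnn.
Qed.

Lemma fn2_halve : fn2 halve.
Proof.
apply: df_ext (df_iteri (df_var 1) (df_var 0)
  (df_if (df_comp1 prn_odd (df_var 0)) (df_var 0) (df_comp1 prn_half (df_var 0)))) _.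
move=> p e; rewrite /halve; elim: (nth 0 e 1) => //= n ->.
by case: (odd _).
Qed.

Lemma prn_headc : prn (fun _ => headc).
Proof.
apply: df_ext (df_iteri (df_var 0) (df_const 0) (df_comp2 fn2_add (df_var 0)
  (df_comp2 fn2_sub (df_const 1)
    (df_comp1 prn_odd (df_comp2 fn2_halve (df_var 2) (df_var 1)))))) _ => p e.
by apply: eq_iteri => i acc /=; case: (odd _).
Qed.

Lemma prn_tailc : prn (fun _ => tailc).
Proof. exact: df_comp1 prn_half (df_comp2 fn2_halve (df_var 0) (df_var 0)). Qed.

(* Functions that are primitive recursive, relative to the oracle, on codes. *)
Definition PR (A B : countType) (f : baire -> A -> B) : Prop :=
  exists2 g, prn g & forall p a, g p (pickle a) = pickle (f p a).

Section Closure.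
Implicit Types A B C : countType.

Lemma PR_ext A B (f g : baire -> A -> B) :
  PR f -> (forall p a, f p a = g p a) -> PR g.
Proof. by move=> [h hh hf] fg; exists h => // p a; rewrite hf fg. Qed.

Lemma PR_id A : PR (fun _ (a : A) => a).
Proof. by exists (fun _ n => n) => //; exact: df_var. Qed.

Lemma PR_cst A B (b : B) : PR (fun _ (_ : A) => b).
Proof. by exists (fun _ _ => pickle b) => //; exact: df_const. Qed.

Lemma PR_comp A B C (h : baire -> B -> C) (f : baire -> A -> B) :
  PR h -> PR f -> PR (fun p a => h p (f p a)).
Proof.
move=> [h' hh hE] [f' hf fE]; exists (fun p n => h' p (f' p n)).
  exact: df_comp1 hh hf.
by move=> p a; rewrite fE hE.
Qed.

(** Only codes matter: a function may be exchanged for one with values in another type if the codes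
    of the values agree. *)
Lemma PR_repickle A B C (f : baire -> A -> B) (g : baire -> A -> C) :
  PR f -> (forall p a, pickle (f p a) = pickle (g p a)) -> PR g.
Proof. by move=> [h hh hf] fg; exists h => // p a; rewrite hf fg. Qed.

Lemma PR_pickle A B (f : baire -> A -> B) :
  PR f -> PR (fun p a => pickle (f p a)).
Proof. by move/PR_repickle; apply. Qed.

Lemma PR_codes A B (f : baire -> A -> B) : 
  PR (fun p a => pickle (f p a)) -> PR f.
Proof. by move/PR_repickle; apply. Qed.

Lemma PR_nat1 A (g : baire -> nat -> nat) (f : baire -> A -> nat) :
  prn g -> PR f -> PR (fun p a => g p (f p a)).
Proof. by move=> hg; apply: PR_comp; exists g. Qed.

Lemma PR_nat2 A (g : nat -> nat -> nat) (u v : baire -> A -> nat) :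
  fn2 g -> PR u -> PR v -> PR (fun p a => g (u p a) (v p a)).
Proof.
move=> hg [u' hu uE] [v' hv vE]; exists (fun p n => g (u' p n) (v' p n)).
  exact: df_comp2 hg hu hv.
by move=> p a; rewrite uE vE.
Qed.

(** The codes unfold to those of lists: a pair is coded as a list of length two, an option as a list
    of length at most one. *)
Lemma pickle_pair A B (a : A) (b : B) :
  pickle (a, b) = consc (pickle a) (consc (pickle b) 0).
Proof. by []. Qed.

Lemma pickle_cons A (x : A) s : pickle (x :: s) = consc (pickle x) (pickle s).
Proof. by []. Qed.

Lemma pickle_some A (x : A) : pickle (Some x) = consc (pickle x) 0.
Proof. by []. Qed.

Lemma pickle_bool (b : bool) : pickle b = b.
Proof. by []. Qed.

Lemma PR_pair A B C (f : baire -> A -> B) (g : baire -> A -> C) :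
  PR f -> PR g -> PR (fun p a => (f p a, g p a)).
Proof.
move=> hf hg; apply: PR_codes; apply: (@PR_nat2 _ consc).
- exact: fn2_consc.
- exact: PR_pickle.
by apply: (@PR_nat2 _ consc); [exact: fn2_consc | exact: PR_pickle | exact: PR_cst].
Qed.

Lemma PR_headc A (f : baire -> A -> nat) : PR f -> PR (fun p a => headc (f p a)).
Proof. by apply: (@PR_nat1 _ (fun=> headc)); exact: prn_headc. Qed.

Lemma PR_tailc A (f : baire -> A -> nat) : PR f -> PR (fun p a => tailc (f p a)).
Proof. by apply: (@PR_nat1 _ (fun=> tailc)); exact: prn_tailc. Qed.

Lemma PR_fst A B C (f : baire -> A -> B * C) : PR f -> PR (fun p a => (f p a).1).
Proof.
move=> hf; apply: PR_codes; apply: PR_ext (PR_headc (PR_pickle hf)) _ => p a.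
by case: (f p a) => b c; rewrite pickle_pair headc_consc.
Qed.

Lemma PR_snd A B C (f : baire -> A -> B * C) : PR f -> PR (fun p a => (f p a).2).
Proof.
move=> hf; apply: PR_codes.
apply: PR_ext (PR_headc (PR_tailc (PR_pickle hf))) _ => p a.
by case: (f p a) => b c; rewrite pickle_pair tailc_consc headc_consc.
Qed.

Lemma PR_succ A (f : baire -> A -> nat) : PR f -> PR (fun p a => (f p a).+1).
Proof.
by apply: (@PR_nat1 _ (fun _ n => n.+1)); exact: df_succ (df_var 0).
Qed.

Lemma PR_pred A (f : baire -> A -> nat) : PR f -> PR (fun p a => (f p a).-1).
Proof. by apply: (@PR_nat1 _ (fun _ n => n.-1)); exact: prn_pred. Qed.

Lemma PR_half A (f : baire -> A -> nat) : PR f -> PR (fun p a => (f p a)./2).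
Proof. by apply: (@PR_nat1 _ (fun _ n => n./2)); exact: prn_half. Qed.

Lemma PR_add A (f g : baire -> A -> nat) :
  PR f -> PR g -> PR (fun p a => f p a + g p a).
Proof. by apply: (@PR_nat2 _ addn); exact: fn2_add. Qed.

Lemma PR_sub A (f g : baire -> A -> nat) :
  PR f -> PR g -> PR (fun p a => f p a - g p a).
Proof. by apply: (@PR_nat2 _ subn); exact: fn2_sub. Qed.

Lemma PR_mul A (f g : baire -> A -> nat) :
  PR f -> PR g -> PR (fun p a => f p a * g p a).
Proof. by apply: (@PR_nat2 _ muln); exact: fn2_mul. Qed.

Lemma PR_orc A (f : baire -> A -> nat) : PR f -> PR (fun p a => p (f p a)).
Proof. by apply: (@PR_nat1 _ (fun p n => p n)); exact: df_orc (df_var 0). Qed.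

Lemma PR_nat_of_bool A (c : baire -> A -> bool) :
  PR c -> PR (fun p a => nat_of_bool (c p a)).
Proof. exact: PR_pickle. Qed.

Lemma PR_if A B (c : baire -> A -> bool) (f g : baire -> A -> B) :
  PR c -> PR f -> PR g -> PR (fun p a => if c p a then f p a else g p a).
Proof.
move=> [c' hc cE] [f' hf fE] [g' hg gE].
exists (fun p n => if c' p n != 0 then f' p n else g' p n); first exact: df_if.
by move=> p a; rewrite cE pickle_bool fE gE; case: (c p a).
Qed.

Lemma PR_odd A (f : baire -> A -> nat) : PR f -> PR (fun p a => odd (f p a)).
Proof.
by move=> hf; apply: PR_codes; apply: (@PR_nat1 _ (fun _ n => odd n)) hf; exact: prn_odd.
Qed.

Lemma PR_neq0 A (f : baire -> A -> nat) : PR f -> PR (fun p a => f p a != 0).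
Proof.
move=> hf; apply: PR_codes; apply: (@PR_nat1 _ (fun _ n => n != 0)) hf.
apply: df_ext (df_if (df_var 0) (df_const 1) (df_const 0)) _ => p e.
by case: eqP.
Qed.

Lemma PR_not A (c : baire -> A -> bool) : PR c -> PR (fun p a => ~~ c p a).
Proof.
by move=> hc; apply: PR_ext (PR_if hc (PR_cst _ false) (PR_cst _ true)) _ => p a; case: ifP.
Qed.

Lemma PR_and A (c d : baire -> A -> bool) :
  PR c -> PR d -> PR (fun p a => c p a && d p a).
Proof.
by move=> hc hd; apply: PR_ext (PR_if hc hd (PR_cst _ false)) _ => p a; case: ifP.
Qed.

Lemma PR_or A (c d : baire -> A -> bool) :
  PR c -> PR d -> PR (fun p a => c p a || d p a).
Proof.
by move=> hc hd; apply: PR_ext (PR_if hc (PR_cst _ true) hd) _ => p a; case: ifP.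
Qed.

Lemma PR_leq A (f g : baire -> A -> nat) :
  PR f -> PR g -> PR (fun p a => f p a <= g p a).
Proof.
move=> hf hg; apply: PR_ext (PR_not (PR_neq0 (PR_sub hf hg))) _ => p a.
by rewrite negbK subn_eq0.
Qed.

Lemma PR_eq A B (f g : baire -> A -> B) :
  PR f -> PR g -> PR (fun p a => f p a == g p a).
Proof.
move=> /PR_pickle hf /PR_pickle hg.
apply: PR_ext (PR_and (PR_leq hf hg) (PR_leq hg hf)) _ => p a.
by rewrite -eqn_leq (inj_eq (pcan_inj pickleK)).
Qed.

Lemma PR_iteri A B (n : baire -> A -> nat) (b : baire -> A -> B)
    (s : baire -> A -> nat -> B -> B) :
  PR n -> PR b -> PR (fun p (x : A * (nat * B)) => s p x.1 x.2.1 x.2.2) ->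
  PR (fun p a => iteri (n p a) (s p a) (b p a)).
Proof.
move=> [n' hn nE] [b' hb bE] [s' hs sE].
exists (fun p x => iteri (n' p x) (fun i acc =>
    s' p (consc x (consc (consc i (consc acc 0)) 0))) (b' p x)).
  apply: (df_iteri hn hb (s := fun p e => s' p (consc (nth 0 e 2)
    (consc (consc (nth 0 e 1) (consc (nth 0 e 0) 0)) 0)))).
  apply: df_comp1 hs _; do ![apply: df_comp2 fn2_consc _ _ | exact: df_var | exact: df_const].
move=> p a; rewrite nE bE /=; elim: (n p a) => //= k ->.
by rewrite -(sE p (a, (k, _))).
Qed.

Lemma PR_cons A B (f : baire -> A -> B) (g : baire -> A -> seq B) :
  PR f -> PR g -> PR (fun p a => f p a :: g p a).
Proof.
move=> hf hg; apply: PR_codes; apply: (@PR_nat2 _ consc).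
- exact: fn2_consc.
- exact: PR_pickle.
- exact: PR_pickle.
Qed.

Lemma PR_behead A B (f : baire -> A -> seq B) :
  PR f -> PR (fun p a => behead (f p a)).
Proof.
move=> hf; apply: PR_codes; apply: PR_ext (PR_tailc (PR_pickle hf)) _ => p a.
by case: (f p a) => //= x s; rewrite pickle_cons tailc_consc.
Qed.

Lemma PR_nilp A B (f : baire -> A -> seq B) : PR f -> PR (fun p a => nilp (f p a)).
Proof.
move=> hf; apply: PR_ext (PR_not (PR_neq0 (PR_pickle hf))) _ => p a.
by rewrite negbK; case: (f p a) => //= x s; rewrite pickle_cons /consc muln_eq0 expn_eq0.
Qed.

Lemma PR_head A B (x : baire -> A -> B) (f : baire -> A -> seq B) :
  PR x -> PR f -> PR (fun p a => seq.head (x p a) (f p a)).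
Proof.
move=> hx hf; apply: PR_codes.
apply: PR_ext (PR_if (PR_nilp hf) (PR_pickle hx) (PR_headc (PR_pickle hf))) _ => p a.
by case: (f p a) => //= y s; rewrite pickle_cons headc_consc.
Qed.

Lemma PR_drop A B (n : baire -> A -> nat) (f : baire -> A -> seq B) :
  PR n -> PR f -> PR (fun p a => drop (n p a) (f p a)).
Proof.
move=> hn hf; have h := PR_behead (PR_snd (PR_snd (PR_id (A * (nat * seq B))%type))).
apply: PR_ext (PR_iteri (s := fun _ _ _ => behead) hn hf h) _ => p a.
by elim: (n p a) => [|k /= ->]; rewrite ?drop0 // -drop1 drop_drop add1n.
Qed.

Lemma PR_nth A B (x : baire -> A -> B) (f : baire -> A -> seq B) (n : baire -> A -> nat) :
  PR x -> PR f -> PR n -> PR (fun p a => nth (x p a) (f p a) (n p a)).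
Proof.
move=> hx hf hn; apply: PR_ext (PR_head hx (PR_drop hn hf)) _ => p a.
by rewrite -nth0 nth_drop addn0.
Qed.

Lemma leq_size_pickle A (s : seq A) : size s <= pickle s.
Proof.
elim: s => //= x s IH; rewrite pickle_cons /consc (leq_ltn_trans IH) //.
rewrite -[X in X < _]mul1n; apply: (@leq_trans (1 * (pickle s).*2.+1)).
  by rewrite !mul1n ltnS -addnn leq_addr.
by rewrite leq_mul2r expn_gt0.
Qed.

(** The size is the number of indices at which the list has not been exhausted; the code of the list
    bounds these indices. *)
Lemma PR_size A B (f : baire -> A -> seq B) : PR f -> PR (fun p a => size (f p a)).
Proof.
move=> hf; have h : PR (fun p (x : A * (nat * nat)) =>
    x.2.2 + ~~ nilp (drop x.2.1 (f p x.1))).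
  apply: PR_add; first exact: PR_snd (PR_snd (PR_id _)).
  apply/PR_nat_of_bool/PR_not/PR_nilp/PR_drop.
    exact: PR_fst (PR_snd (PR_id _)).
  exact: PR_comp hf (PR_fst (PR_id _)).
apply: PR_ext (PR_iteri (s := fun p a i acc => acc + ~~ nilp (drop i (f p a)))
   (PR_pickle hf) (PR_cst _ 0) h) _ => p a.
have := leq_size_pickle (f p a); move: (pickle (f p a)) => n.
suff -> : iteri n (fun i acc => acc + ~~ nilp (drop i (f p a))) 0 = minn n (size (f p a)).
  by move/minn_idPr.
elim: n => [|n IH]; first by rewrite min0n.
by rewrite /= IH /nilp size_drop subn_eq0 -ltnNge; case: ltnP; lia.
Qed.

(** The iteration puts entries in front, so the list is built from its last entry to its first;
    hence the index [(n p a).-1 - i]. *)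
Lemma PR_mkseq A B (f : baire -> A -> nat -> B) (n : baire -> A -> nat) :
  PR (fun p (x : A * nat) => f p x.1 x.2) -> PR n ->
  PR (fun p a => mkseq (f p a) (n p a)).
Proof.
move=> hf hn.
have h : PR (fun p (x : A * (nat * seq B)) =>
    f p x.1 ((n p x.1).-1 - x.2.1) :: x.2.2).
  apply: PR_cons; last exact: PR_snd (PR_snd (PR_id _)).
  apply: PR_comp hf (PR_pair (PR_fst (PR_id _)) _).
  apply: PR_sub; last exact: PR_fst (PR_snd (PR_id _)).
  by apply/PR_pred/(PR_comp hn)/PR_fst/PR_id.
apply: PR_ext (PR_iteri (s := fun p a i acc => f p a ((n p a).-1 - i) :: acc)
   hn (PR_cst _ [::]) h) _ => p a.
have main k : k <= n p a ->
   iteri k (fun i acc => f p a ((n p a).-1 - i) :: acc) [::] =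
   [seq f p a i | i <- iota (n p a - k) k].
  elim: k => [|k IH] kn //=; rewrite IH 1?ltnW //.
  by rewrite -predn_sub -subnS subnSK.
by rewrite main // subnn.
Qed.

Lemma PR_foldr A B C (x0 : B) (f : baire -> A -> B -> C -> C)
    (b : baire -> A -> C) (s : baire -> A -> seq B) :
  PR (fun p (x : A * (B * C)) => f p x.1 x.2.1 x.2.2) -> PR b -> PR s ->
  PR (fun p a => foldr (f p a) (b p a) (s p a)).
Proof.
move=> hf hb hs.
have h : PR (fun p (x : A * (nat * C)) =>
    f p x.1 (nth x0 (s p x.1) ((size (s p x.1)).-1 - x.2.1)) x.2.2).
  have hs1 : PR (fun p (x : A * (nat * C)) => s p x.1).
    exact: PR_comp hs (PR_fst (PR_id _)).
  apply: PR_comp hf (PR_pair (PR_fst (PR_id _)) (PR_pair _ (PR_snd (PR_snd (PR_id _))))).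
  apply: (PR_nth (PR_cst _ _) hs1).
  exact: PR_sub (PR_pred (PR_size hs1)) (PR_fst (PR_snd (PR_id _))).
apply: PR_ext (PR_iteri (s := fun p a i acc =>
  f p a (nth x0 (s p a) ((size (s p a)).-1 - i)) acc) (PR_size hs) hb h) _ => p a.
set t := s p a.
have main k : k <= size t ->
   iteri k (fun i acc => f p a (nth x0 t ((size t).-1 - i)) acc) (b p a) =
   foldr (f p a) (b p a) (drop (size t - k) t).
  elim: k => [|k IH] kn; first by rewrite subn0 drop_size.
  rewrite /= IH 1?ltnW // -predn_sub -subnS.
  by rewrite [drop (_ - k.+1) t](drop_nth x0) ?subnSK //; lia.
by rewrite main // subnn drop0.
Qed.

Lemma PR_some A B (f : baire -> A -> B) : PR f -> PR (fun p a => Some (f p a)).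
Proof.
by move=> hf; apply: PR_repickle (PR_cons hf (PR_cst _ [::])) _.
Qed.

(** [None] has the code 0, and the code of [Some b] is a non-zero list code whose head is the code
    of [b]. *)
Lemma PR_omatch A B C (f : baire -> A -> option B) (g : baire -> A -> B -> C)
    (h : baire -> A -> C) :
  PR f -> PR (fun p (x : A * B) => g p x.1 x.2) -> PR h ->
  PR (fun p a => if f p a is Some b then g p a b else h p a).
Proof.
move=> /PR_pickle hf [g' hg gE] hh; apply: PR_codes.
have H : PR (fun p a => g' p (consc (pickle a) (consc (headc (pickle (f p a))) 0))).
  apply: (PR_nat1 hg); apply: (@PR_nat2 _ consc) => //.
  - exact: fn2_consc.
  - exact: PR_pickle (PR_id A).
  - apply: (@PR_nat2 _ consc); [exact: fn2_consc | exact: PR_headc | exact: PR_cst].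
apply: PR_ext (PR_if (PR_neq0 hf) H (PR_pickle hh)) _ => p a.
case E: (f p a) => [b|] //.
rewrite pickle_some headc_consc {1}/consc muln_eq0 expn_eq0 /=.
by rewrite -(gE p (a, b)).
Qed.

End Closure.

(** * Simulation of Turing machines *)

(** Primitive recursiveness is derived by recursion on the expression: its outermost function
    selects the closure property, and an expression without a matching one is tried as a
    constant. *)
Ltac pr_step := lazymatch goal with
  | H : PR ?f |- PR ?f => exact: H
  | |- @PR _ _ ?F => lazymatch F with
    | fun p a => a => exact: PR_id
    | fun p a => fst (@?f p a) => apply: PR_fst
    | fun p a => snd (@?f p a) => apply: PR_snd
    | fun p a => pair (@?f p a) (@?g p a) => apply: PR_pair
    | fun p a => S (@?f p a) => apply: PR_succ
    | fun p a => predn (@?f p a) => apply: PR_pred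
    | fun p a => addn (@?f p a) (@?g p a) => apply: PR_add
    | fun p a => subn (@?f p a) (@?g p a) => apply: PR_sub
    | fun p a => muln (@?f p a) (@?g p a) => apply: PR_mul
    | fun p a => half (@?f p a) => apply: PR_half
    | fun p a => if _ then _ else _ => apply: PR_if
    | fun p a => odd (@?f p a) => apply: PR_odd
    | fun p a => nat_of_bool (@?f p a) => apply: PR_nat_of_bool
    | fun p a => negb (@?f p a) => apply: PR_not
    | fun p a => andb (@?f p a) (@?g p a) => apply: PR_and
    | fun p a => orb (@?f p a) (@?g p a) => apply: PR_or
    | fun p a => leq (@?f p a) (@?g p a) => apply: PR_leq
    | fun p a => eq_op (@?f p a) (@?g p a) => apply: PR_eq
    | fun p a => cons (@?f p a) (@?g p a) => apply: PR_cons
    | fun p a => behead (@?f p a) => apply: PR_behead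
    | fun p a => drop (@?f p a) (@?g p a) => apply: PR_drop
    | fun p a => nth (@?x p a) (@?f p a) (@?g p a) => apply: PR_nth
    | fun p a => size (@?f p a) => apply: PR_size
    | fun p a => Some (@?f p a) => apply: PR_some
    | fun p a => mkseq (@?f p a) (@?n p a) => apply: PR_mkseq
    | fun p a => iteri (@?n p a) (@?f p a) (@?b p a) => apply: PR_iteri
    | fun p a => ?f p (@?g p a) =>
        match goal with H : PR f |- _ => apply: (PR_comp H) end
    | fun p a => p (@?g p a) => apply: PR_orc
    | _ => exact: PR_cst
    end
  end.
Ltac pr_ext := fail.
Ltac pr := repeat (first [pr_step | pr_ext]; cbn beta).

Lemma iteri_or (P : nat -> bool) n :
  iteri n (fun i b => b || P i) false = [exists i : 'I_n, P i].
Proof.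
elim: n => [|n /= ->]; first by symmetry; apply/negbTE/existsP => -[[]].
apply/orP/existsP => [[/existsP[i Hi]|Hn]|[[i] /=]].
- by exists (widen_ord (leqnSn n) i).
- by exists ord_max.
- rewrite ltnS leq_eqVlt => /orP[/eqP -> ->|ilt Hi]; first by right.
  by left; apply/existsP; exists (Ordinal ilt).
Qed.

Section UnaryPR.
Variable p : baire.

(** The zeros are exactly the last cells of blocks, so cell [j] holds a zero iff a later block
    starts in cell [j.+1]. As blocks are not empty, the search for its index is bounded. *)
Lemma unaryN j : ~~ unary p j = [exists i : 'I_j.+1, pos p i.+1 == j.+1].
Proof.
have [n [m [jE mn]]] := pos_split p j; have nj : n < j.+1.
  by rewrite ltnS jE (leq_trans (leq_pos p n)) // leq_addr.
rewrite {1}jE unary_pos // -leqNgt; apply/idP/existsP => [nm|[i /eqP E]].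
  by exists (Ordinal nj); rewrite posS /= jE; apply/eqP; lia.
rewrite leqNgt; apply/negP => mn'.
have [le|le] := leqP i.+1 n; first by have := pos_leq p le; lia.
by have := pos_leq p le; rewrite posS; lia.
Qed.

Lemma pos_iteri n : pos p n = iteri n (fun i acc => acc + (p i).+1) 0.
Proof. by elim: n => [|n IH]; rewrite ?posS ?IH // /pos big_ord0. Qed.

Lemma unary_iteri j : unary p j =
  ~~ iteri j.+1 (fun i acc => acc || (pos p i.+1 == j.+1)) false.
Proof.
by rewrite iteri_or -unaryN negbK.
Qed.

End UnaryPR.

Lemma PR_unary (A : countType) (x : baire -> A * nat -> nat) (j : baire -> A -> nat) :
  PR x -> PR j -> PR (fun p a => unary (fun n => x p (a, n)) (j p a)).
Proof.
move=> hx hj; apply: (@PR_ext _ _ (fun p a => ~~ iteri (j p a).+1 (fun i acc =>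
  acc || (iteri i.+1 (fun l s => s + (x p (a, l)).+1) 0 == (j p a).+1)) false)).
  by pr.
move=> p a; rewrite unary_iteri; congr (~~ _).
by apply: eq_iteri => i acc; rewrite pos_iteri.
Qed.

(* Configurations in which every position [z] is stored as the natural number
   [z + T]; this is faithful during the first [T] steps. *)
Definition rinstr : Type :=
  ((nat * seq symbol) * ((nat * move) * seq (symbol * move)))%type.
Definition rtape : Type := (nat * seq symbol)%type.
Definition rconfig : Type := (nat * (nat * seq rtape))%type.

HB.instance Definition _ := Countable.on rinstr.
HB.instance Definition _ := Countable.on rtape.
HB.instance Definition _ := Countable.on rconfig.

Definition rblank : rtape := (0, [::]).
Definition rread (t : rtape) : symbol := nth None t.2 t.1.
Definition rshift (d : move) (z : nat) : nat :=
  if d == Left then z.-1 else if d == Right then z.+1 else z.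
Definition ract (a : symbol * move) (t : rtape) : rtape :=
  (rshift a.2 t.1,
   mkseq (fun z => if z == t.1 then a.1 else nth None t.2 z) (size t.2 + t.1.+1)).
Definition rscanned (s : symbol) (c : rconfig) : seq symbol :=
  s :: mkseq (fun i => rread (nth rblank c.2.2 i)) (size c.2.2).
Definition rapply (c : rconfig) (a : (nat * move) * seq (symbol * move)) : rconfig :=
  (a.1.1, (rshift a.1.2 c.2.1,
    mkseq (fun i => ract (nth (None, Stay) a.2 i) (nth rblank c.2.2 i))
      (size c.2.2))).
Definition rstep (prog : seq rinstr) (s : symbol) (c : rconfig) : option rconfig :=
  foldr (fun e acc => if e.1 == (c.1, rscanned s c) then Some (rapply c e.2)
                      else acc) None prog.
Definition rinput (x : nat -> nat) (T z : nat) : symbol :=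
  if z < T then None else Some (unary x (z - T)).
Definition rnext (prog : seq rinstr) (x : nat -> nat) (T : nat) (c : rconfig) :=
  if rstep prog (rinput x T c.2.1) c is Some c' then c' else c.
Definition rinit (k T : nat) : rconfig :=
  (0, (T, mkseq (fun=> (T, [::])) k.+1)).
Definition rrun (k : nat) (prog : seq rinstr) (x : nat -> nat) (T : nat) : rconfig :=
  iteri T (fun=> rnext prog x T) (rinit k T).

Section SimulationPR.
Variable A : countType.

Lemma PR_rread (t : baire -> A -> rtape) : PR t -> PR (fun p a => rread (t p a)).
Proof. by move=> ht; rewrite /rread; pr. Qed.

Lemma PR_rshift (d : baire -> A -> move) (z : baire -> A -> nat) :
  PR d -> PR z -> PR (fun p a => rshift (d p a) (z p a)).
Proof. by move=> hd hz; rewrite /rshift; pr. Qed.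

Lemma PR_ract (d : baire -> A -> symbol * move) (t : baire -> A -> rtape) :
  PR d -> PR t -> PR (fun p a => ract (d p a) (t p a)).
Proof. by move=> hd ht; rewrite /ract /rshift; pr. Qed.

Lemma PR_rscanned (s : baire -> A -> symbol) (c : baire -> A -> rconfig) :
  PR s -> PR c -> PR (fun p a => rscanned (s p a) (c p a)).
Proof. by move=> hs hc; rewrite /rscanned /rread; pr. Qed.

Lemma PR_rinput (x : baire -> A * nat -> nat) (T z : baire -> A -> nat) :
  PR x -> PR T -> PR z ->
  PR (fun p a => rinput (fun n => x p (a, n)) (T p a) (z p a)).
Proof. by move=> hx hT hz; rewrite /rinput; pr; apply: PR_unary; pr. Qed.
End SimulationPR.

Ltac pr_ext ::= lazymatch goal with
  | |- @PR _ _ ?F => lazymatch F with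
    | fun p a => rread (@?t p a) => apply: PR_rread
    | fun p a => rshift (@?d p a) (@?t p a) => apply: PR_rshift
    | fun p a => ract (@?d p a) (@?t p a) => apply: PR_ract
    | fun p a => rscanned (@?d p a) (@?t p a) => apply: PR_rscanned
    end
  end.

Lemma PR_rapply (A : countType) (c : baire -> A -> rconfig)
    (d : baire -> A -> (nat * move) * seq (symbol * move)) :
  PR c -> PR d -> PR (fun p a => rapply (c p a) (d p a)).
Proof. by move=> hc hd; rewrite /rapply; pr. Qed.

Lemma PR_rstep (A : countType) (prog : baire -> A -> seq rinstr)
    (s : baire -> A -> symbol) (c : baire -> A -> rconfig) :
  PR prog -> PR s -> PR c -> PR (fun p a => rstep (prog p a) (s p a) (c p a)).
Proof.
move=> hp hs hc; apply: (PR_foldr (0, [::], (0, Stay, [::]))); pr.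
by apply: PR_rapply; pr.
Qed.

Lemma PR_rrun (A : countType) (k : baire -> A -> nat) (prog : baire -> A -> seq rinstr)
    (x : baire -> A * nat -> nat) (T : baire -> A -> nat) :
  PR k -> PR prog -> PR x -> PR T ->
  PR (fun p a => rrun (k p a) (prog p a) (fun n => x p (a, n)) (T p a)).
Proof.
move=> hk hp hx hT; apply: PR_iteri => //; first by rewrite /rinit; pr.
apply: PR_omatch; [|by pr|by pr].
apply: PR_rstep; [by pr | | by pr].
by apply: (PR_rinput (x := fun p y => x p (y.1.1, y.2))); pr.
Qed.

Definition raw_instr k (e : instr k) : rinstr :=
  ((e.1.1, tval e.1.2), (e.2.1, tval e.2.2)).

Definition raw_prog k (prog : seq (instr k)) : seq rinstr := map (@raw_instr k) prog.

(** * Faithfulness of the simulation on natural numbers *)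

Section Simulation.
Variables (x : baire) (T : nat).

(** After [i] steps a head is at most [i] cells away from the origin. As long as [i < T], its
    shifted position is positive, so the truncated predecessor in [rshift] is a true move to the
    left. *)
Definition rel_pos (i : nat) (z : int) (n : nat) : Prop :=
  (Posz n = z + Posz T)%R /\ (`|z|%N <= i).

Definition rel_tape (i : nat) (t : tape) (rt : rtape) : Prop :=
  rel_pos i (head t) rt.1 /\ forall z, nth None rt.2 z = cells t (Posz z - Posz T)%R.

Definition rel k (i : nat) (c : config k) (rc : rconfig) : Prop :=
  [/\ rc.1 = state c, rel_pos i (head (input c)) rc.2.1,
      cells (input c) = cells (input_tape x), size rc.2.2 = k.+1 &
      forall j : 'I_k.+1, rel_tape i (tnth (tapes c) j) (nth rblank rc.2.2 j)].

Lemma rel_shift i d z n : i < T -> rel_pos i z n -> rel_pos i.+1 (shift d z) (rshift d n).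
Proof. by move=> iT [E le]; case: d; rewrite /rshift /shift /=; split; lia. Qed.

Lemma rel_read i t rt : rel_tape i t rt -> rread rt = read t.
Proof. by move=> [[E _] H]; rewrite /rread H E addrK. Qed.

Lemma rel_act i a t rt : i < T -> rel_tape i t rt -> rel_tape i.+1 (act a t) (ract a rt).
Proof.
move=> iT [Hp Hc]; split; first exact: rel_shift.
move=> z /=; have [E _] := Hp.
have -> : ((Posz z - Posz T)%R == head t) = (z == rt.1) by apply/eqP/eqP; lia.
case: (ltnP z (size rt.2 + rt.1.+1)) => zs.
  by rewrite nth_mkseq // Hc.
rewrite nth_default ?size_mkseq // -Hc nth_default; last first.
  by rewrite (leq_trans _ zs) // leq_addr.
by rewrite gtn_eqF // (leq_trans _ zs) // addnS ltnS leq_addl.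
Qed.

Lemma rel_input i k (c : config k) rc : rel i c rc -> rinput x T rc.2.1 = read (input c).
Proof.
case=> _ [E le] Ei _ _; rewrite /rinput /read Ei.
have -> : head (input c) = (Posz rc.2.1 - Posz T)%R by lia.
by case: ltnP => h; [case E': (_ - _)%R => [n|n] //=; lia | rewrite subzn].
Qed.

Lemma rel_scanned i k (c : config k) rc : rel i c rc ->
  rscanned (rinput x T rc.2.1) rc = scanned c.
Proof.
move=> H; have -> := rel_input H; case: H => _ _ _ Es Ht.
congr (_ :: _); apply: (@eq_from_nth _ None).
  by rewrite size_mkseq size_map size_tuple.
move=> j; rewrite size_mkseq => js.
rewrite nth_mkseq //; rewrite Es in js.
rewrite (nth_map blank_tape) ?size_tuple //.
by rewrite (rel_read (Ht (Ordinal js))) (tnth_nth blank_tape).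
Qed.

Lemma rstep_cons e prog s c : rstep (e :: prog) s c =
  if e.1 == (c.1, rscanned s c) then Some (rapply c e.2) else rstep prog s c.
Proof. by []. Qed.

(** Related configurations scan the same symbols, so both programs select the same first applicable
    instruction. *)
Lemma rel_step k (prog : seq (instr k)) i c rc (s := rinput x T rc.2.1) : rel i c rc ->
  step prog c = None /\ rstep (raw_prog prog) s rc = None \/
  exists c' rc', [/\ step prog c = Some c', rstep (raw_prog prog) s rc = Some rc' &
    i < T -> rel i.+1 c' rc'].
Proof.
move=> H; elim: prog => [|e prog IH]; first by left.
have E : ((raw_instr e).1 == (rc.1, rscanned s rc)) =
    (e.1 == (state c, scanned c)).
  rewrite (rel_scanned H); case: H => -> _ _ _ _.
  by case: e => [[a b] d]; rewrite !xpair_eqE.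
rewrite step_cons [raw_prog _]/= rstep_cons E.
case: eqP => // _.
right; eexists; eexists; split=> // iT.
case: H => [E0 E1 E2 E3 E4]; split=> //=.
- exact: rel_shift.
- by rewrite size_mkseq.
- move=> j; rewrite tnth_mktuple nth_mkseq ?E3 //.
  by rewrite -tnth_nth; apply: rel_act.
Qed.

Lemma rel_init k : rel 0 (init k x) (rinit k T).
Proof.
split; [by []|by split; rewrite ?add0r|by []|by rewrite size_mkseq|].
move=> j; rewrite tnth_mktuple nth_mkseq //; split=> /=; first by split; rewrite ?add0r.
by move=> z; rewrite nth_nil.
Qed.

Lemma rel_run k (prog : seq (instr k)) n : n <= T ->
  rel n (run prog x n) (iteri n (fun=> rnext (raw_prog prog) x T) (rinit k T)).
Proof.
elim: n => [_|n IH nT]; first exact: rel_init.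
have H := IH (ltnW nT); rewrite /= /rnext.
have [[E1 E2]|[c' [rc' [E1 E2 H']]]] := rel_step prog H.
  rewrite E1 E2 /=; case: H => [E0 [e1 e1'] e2 e3 e4].
  split=> //; first by split; rewrite // leqW.
  by move=> j; have [[f1 f2] f3] := e4 j; split=> //; split; rewrite // leqW.
by rewrite E1 E2 /=; exact: H'.
Qed.

Lemma rrun_output (M : machine) z :
  nth None (nth rblank (rrun (tag M) (raw_prog (tagged M)) x T).2.2 0).2 (z + T) =
  cells (output (run (tagged M) x T)) (Posz z).
Proof.
have [_ _ _ _ /(_ ord0) [_ H]] := rel_run (tagged M) (leqnn T).
by rewrite [LHS]H; congr (cells _ _); lia.
Qed.

Lemma rrun_halts (M : machine) (c := rrun (tag M) (raw_prog (tagged M)) x T) :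
  isSome (rstep (raw_prog (tagged M)) (rinput x T c.2.1) c) =
  isSome (step (tagged M) (run (tagged M) x T)).
Proof.
have H := rel_run (tagged M) (leqnn T).
by have [[-> ->]|[c' [rc' [-> -> _]]]] := rel_step (tagged M) H.
Qed.

End Simulation.

Lemma PR_output (A : countType) (M : machine) (x : baire -> A * nat -> nat)
    (T z : baire -> A -> nat) : PR x -> PR T -> PR z ->
  PR (fun p a => cells (output (run (tagged M) (fun n => x p (a, n)) (T p a)))
                   (Posz (z p a))).
Proof.
move=> hx hT hz.
have h : PR (fun p a => rrun (tag M) (raw_prog (tagged M)) (fun n => x p (a, n)) (T p a)).
  by apply: PR_rrun => //; apply: PR_cst.
apply: PR_ext (_ : PR (fun p a => nth None (nth rblank
  (rrun (tag M) (raw_prog (tagged M)) (fun n => x p (a, n)) (T p a)).2.2 0).2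
    (z p a + T p a))) _.
  by pr.
by move=> p a; rewrite rrun_output.
Qed.

(** * Decoding of machines *)

Lemma PR_pmap (A B C : countType) (x0 : B) (f : baire -> A -> B -> option C)
    (s : baire -> A -> seq B) :
  PR (fun p (x : A * B) => f p x.1 x.2) -> PR s ->
  PR (fun p a => pmap (f p a) (s p a)).
Proof.
move=> hf hs.
have h : PR (fun p (x : A * (B * seq C)) =>
    if f p x.1 x.2.1 is Some y then y :: x.2.2 else x.2.2).
  apply: PR_omatch; [|by pr|by pr].
  by apply: (PR_comp hf (f := fun _ x => (x.1, x.2.1))); pr.
apply: PR_ext (PR_foldr (f := fun p a x acc => if f p a x is Some y then y :: acc else acc)
  x0 h (PR_cst _ [::]) hs) _ => p a.
by elim: (s p a) => //= x t <-; case: (f p a x).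
Qed.

(** A list of numbers is pickled as its own [CodeSeq] code, so decoding does not change the code. *)
Lemma PR_decode (A : countType) (f : baire -> A -> nat) :
  PR f -> PR (fun p a => CodeSeq.decode (f p a)).
Proof.
move=> hf; apply: (PR_repickle hf) => p a.
rewrite -[LHS](CodeSeq.decodeK (f p a)); congr CodeSeq.code.
exact: esym (map_id _).
Qed.

(* The codes of the elements of [T k], read as elements of [R] by means of
   [raw], uniformly in [k]. *)
Definition decodable (T : nat -> countType) (R : countType)
    (raw : forall k, T k -> R) : Prop :=
  PR (fun _ (x : nat * nat) => omap (raw x.1) (unpickle x.2 : option (T x.1))).

Lemma decodable_cst (A : countType) :
  PR (fun _ n => unpickle n : option A) -> decodable (fun _ (x : A) => x).
Proof.
move=> h; apply: PR_ext (PR_comp h (PR_snd (PR_id (nat * nat)%type))) _ => p x.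
by case: (unpickle _).
Qed.

Lemma unpickle_pair (A B : countType) n : unpickle n =
  if CodeSeq.decode n is [:: a; b]
  then obind (fun x : A => omap (pair x) (unpickle b : option B)) (unpickle a)
  else None.
Proof.
transitivity (obind (fun y : {_ : A & B} => Some (pair_of_tag y))
  (@unpickle_tagged A (fun=> B) n)); first by [].
rewrite /unpickle_tagged.
case: (CodeSeq.decode n) => [|a [|b [|c s]]] //=.
by case: (unpickle a) => //= x; case: (unpickle b).
Qed.

Lemma decodable_pair (T1 T2 : nat -> countType) (R1 R2 : countType)
    (raw1 : forall k, T1 k -> R1)
    (raw2 : forall k, T2 k -> R2) :
  decodable raw1 -> decodable raw2 ->
  @decodable (fun k => (T1 k * T2 k)%type) (R1 * R2)%type
    (fun k x => (raw1 k x.1, raw2 k x.2)).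
Proof.
move=> h1 h2.
pose d (x : nat * nat) i := nth 0 (CodeSeq.decode x.2) i.
have hd i : PR (fun _ x => d x i).
  by apply: PR_nth; [pr | apply: PR_decode; pr | pr].
have h : PR (fun _ (x : nat * nat) => if size (CodeSeq.decode x.2) == 2 then
    if omap (raw1 x.1) (unpickle (d x 0)) is Some y then
      if omap (raw2 x.1) (unpickle (d x 1)) is Some z then Some (y, z) else None
    else None else None).
  apply: PR_if; [|apply: PR_omatch|by pr].
  - by apply: PR_eq; [apply: PR_size; apply: PR_decode; pr | pr].
  - by apply: (PR_comp h1 (f := fun _ x => (x.1, d x 0))); pr.
  - apply: PR_omatch; [|by pr|by pr].
    apply: (PR_comp h2 (f := fun _ (x : (nat * nat) * R1) => (x.1.1, d x.1 1))).
    by apply: PR_pair; [pr | apply: (PR_comp (hd 1)); pr].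
  - by pr.
apply: PR_ext h _ => p x; rewrite unpickle_pair /d.
case: (CodeSeq.decode x.2) => [|a [|b [|c s]]] //=.
by case: (unpickle a) => //= y; case: (unpickle b).
Qed.

Lemma PR_unpickle_nat : PR (fun _ n => unpickle n : option nat).
Proof. by apply: PR_some; pr. Qed.

Lemma PR_unpickle_bool : PR (fun _ n => unpickle n : option bool).
Proof. by apply: PR_some; pr. Qed.

Lemma PR_omap (A B C : countType) (f : baire -> B -> C) (s : baire -> A -> option B) :
  PR f -> PR s -> PR (fun p a => omap (f p) (s p a)).
Proof.
move=> hf hs; apply: PR_omatch => //; last by pr.
by apply: PR_some; apply: (PR_comp hf); pr.
Qed.

Lemma PR_ohead (A B : countType) (s : baire -> A -> seq B) :
  PR s -> PR (fun p a => ohead (s p a)).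
Proof.
move=> hs; apply: PR_codes.
apply: (@PR_ext _ _ (fun p a =>
    if nilp (s p a) then 0 else consc (headc (pickle (s p a))) 0)).
  apply: PR_if; [exact: PR_nilp | by pr |].
  apply: (@PR_nat2 _ consc); [exact: fn2_consc | | by pr].
  exact: PR_headc (PR_pickle hs).
by move=> p a; case: (s p a) => //= x t; rewrite pickle_cons headc_consc.
Qed.

Lemma PR_unpickle_option (A : countType) : PR (fun _ n => unpickle n : option A) ->
  PR (fun _ n => unpickle n : option (option A)).
Proof.
move=> h; apply: PR_some; apply: PR_ohead; apply: (PR_pmap 0).
  by apply: (PR_comp h (f := fun _ x => x.2)); pr.
by apply: PR_decode; pr.
Qed.

Lemma PR_unpickle_symbol : PR (fun _ n => unpickle n : option symbol).
Proof. exact: PR_unpickle_option PR_unpickle_bool. Qed.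

Lemma PR_unpickle_move : PR (fun _ n => unpickle n : option move).
Proof.
have hd : PR (fun _ (o : symbol) => move_decode o).
  apply: (@PR_ext _ _ (fun _ (o : symbol) => if o == Some false then Left
    else if o == None then Stay else Right)); first by pr.
  by move=> p [[]|].
apply: PR_ext (PR_omap hd PR_unpickle_symbol) _ => p n.
by [].
Qed.

Lemma PR_unpickle_pair (A B : countType) : PR (fun _ n => unpickle n : option A) ->
  PR (fun _ n => unpickle n : option B) -> PR (fun _ n => unpickle n : option (A * B)%type).
Proof.
move=> /decodable_cst hA /decodable_cst hB.
have h := PR_comp (decodable_pair hA hB) (PR_pair (PR_cst _ 0) (PR_id nat)).
by apply: PR_ext h _ => p n /=; case: (unpickle n) => [[x y]|].
Qed.

(** A tuple is coded as the list of its entries: entries that cannot be decoded are dropped, and the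
    length is then compared with [m k]. *)
Lemma decodable_tuple (A : countType) (m : nat -> nat) :
  PR (fun _ n => unpickle n : option A) -> PR (fun _ k => m k) ->
  @decodable (fun k => (m k).-tuple A) (seq A) (fun k (t : (m k).-tuple A) => tval t).
Proof.
move=> hA hm; pose s (x : nat * nat) : seq A := pmap unpickle (CodeSeq.decode x.2).
have hs : PR (fun _ x => s x).
  apply: (PR_pmap 0); last by apply: PR_decode; pr.
  by apply: (PR_comp hA (f := fun _ x => x.2)); pr.
have h : PR (fun _ x => if size (s x) == m x.1 then Some (s x) else None).
  by pr; apply: (PR_comp hm (f := fun _ x => x.1)); pr.
apply: PR_ext h _ => p x.
transitivity (omap (@tval _ _) (insub (s x) : option ((m x.1).-tuple A))); last by [].
by case: insubP => [u -> <-|/negPf ->].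
Qed.

Lemma decodable_instr : @decodable (fun k => instr k) rinstr raw_instr.
Proof.
apply: (decodable_pair (decodable_pair (decodable_cst PR_unpickle_nat)
    (decodable_tuple (m := fun k => k.+2) PR_unpickle_symbol _))
  (decodable_pair (decodable_cst (PR_unpickle_pair PR_unpickle_nat PR_unpickle_move))
    (decodable_tuple (m := fun k => k.+1) (PR_unpickle_pair PR_unpickle_symbol PR_unpickle_move) _))); by pr.
Qed.

(** Raw instructions have one type for all numbers of tapes, so a machine can be treated as a
    function of its code. *)
Definition raw_machine (i : nat) : nat * seq rinstr :=
  (tag (nth_machine i), raw_prog (tagged (nth_machine i))).

Lemma PR_raw_machine : PR (fun _ i => raw_machine i).
Proof.
pose f (x : nat * nat) := pmap (fun n => omap (@raw_instr x.1) (unpickle n)) (CodeSeq.decode x.2).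
have hf : PR (fun _ x => f x).
  apply: (PR_pmap 0); last by apply: PR_decode; pr.
  by apply: (PR_comp decodable_instr (f := fun _ x => (x.1.1, x.2))); pr.
pose d i j := nth 0 (CodeSeq.decode i) j.
have hd j : PR (fun _ i => d i j).
  by apply: PR_nth; [pr | apply: PR_decode; pr | pr].
have h : PR (fun _ i => if size (CodeSeq.decode i) == 2 then
    (d i 0, f (d i 0, d i 1)) else (0, [::])).
  apply: PR_if; last by pr.
    by apply: PR_eq; [apply: PR_size; apply: PR_decode; pr | pr].
  have := hd 0; have := hd 1 => h1 h0; pr.
  by apply: (PR_comp hf (f := fun _ i => (d i 0, d i 1))); pr.
apply: PR_ext h _ => p i; rewrite /raw_machine /nth_machine /d /f.
rewrite [unpickle i]/(unpickle _) /= /unpickle_tagged.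
case: (CodeSeq.decode i) => [|k [|n [|? ?]]] //=.
rewrite /raw_prog; congr (_, _).
by elim: (CodeSeq.decode n) => //= x s ->; case: (unpickle x).
Qed.

(** * Approximations of the halting problem, and reductions to it *)

Definition halt_approx (i T : nat) : bool :=
  ~~ isSome (step (tagged (nth_machine i)) (run (tagged (nth_machine i)) zeros T)).

Lemma PR_isSome (A B : countType) (f : baire -> A -> option B) :
  PR f -> PR (fun p a => isSome (f p a)).
Proof.
move=> hf; apply: PR_ext (PR_not (PR_eq hf (PR_cst _ None))) _ => p a.
by case: (f p a).
Qed.

Lemma PR_halt_approx : PR (fun _ (x : nat * nat) => halt_approx x.1 x.2).
Proof.
pose f (x : nat * nat) := rrun (raw_machine x.1).1 (raw_machine x.1).2 (fun=> 0) x.2.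
have hraw := PR_raw_machine.
have hm : PR (fun _ (x : nat * nat) => raw_machine x.1).
  by apply: (PR_comp hraw (f := fun _ x => x.1)); pr.
have hf : PR (fun _ x => f x).
  by apply: (PR_rrun (x := fun _ _ => 0)); pr.
have h : PR (fun _ x => ~~ isSome (rstep (raw_machine x.1).2
    (rinput (fun=> 0) x.2 (f x).2.1) (f x))).
  apply: PR_not; apply: PR_isSome; apply: PR_rstep => //; first by pr.
  by apply: (PR_rinput (x := fun _ _ => 0)); pr.
by apply: PR_ext h _ => p x; rewrite /halt_approx /f rrun_halts.
Qed.

Lemma halt_approx_mono i T T' : T <= T' -> halt_approx i T -> halt_approx i T'.
Proof.
move=> TT hT; rewrite /halt_approx -(subnK TT) /run iterD.
rewrite -/(run _ _ _); elim: (T' - T) => // n IH /=.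
by case E: (step _ (iter n _ _)) IH => [c|] //=; rewrite E.
Qed.

Lemma haltsP i : halts (nth_machine i) zeros <-> exists T, halt_approx i T.
Proof.
by split=> -[T hT]; exists T; move: hT; rewrite /halt_approx; case: step.
Qed.

(** A halted machine remains halted, so the approximations change at most once. *)
Lemma halting_approx i : exists N, forall T, N <= T -> halting i = halt_approx i T.
Proof.
rewrite /halting; case: asboolP => h.
  move/haltsP: h => [N hN]; exists N => T NT.
  by rewrite (halt_approx_mono NT hN).
exists 0 => T _; case E: (halt_approx i T) => //.
by case: h; apply/haltsP; exists T.
Qed.

(** The term [t] is fixed, and the parameter enters only through the states and the number of the
    loading instructions. *)
Lemma PR_param_machine t : PR (fun _ m => param_machine t m).
Proof.
set k := regs (search t); set base := (csize (search t)).+2.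
have hmk (A : countType) (q q' : baire -> A -> nat) r (d : move) w :
    PR q -> PR q' ->
    PR (fun p a => mk_instr (k := k) (q p a) r (q' p a, (d, w))).
  by move=> hq hq'; rewrite /mk_instr /=; pr.
have hl : PR (fun _ m => load_param t m).
  apply: PR_iteri; [by pr | by pr |].
  by apply: PR_cons; [apply: hmk; pr | pr].
have h : PR (fun _ m => (k, mk_instr 0 (scan_init t)
    (param_mark (base + m) (scan_init t)) :: load_param t m)).
  by apply: PR_pair; [pr | apply: PR_cons => //; apply: hmk; pr].
by apply: (PR_repickle h).
Qed.

(** An unbounded search for a witness of a decidable property is a halting question: the code of [a]
    is hard-wired into a search machine, whose own code is primitive recursive in [a]. *)
Lemma search_index (A : countType) (D : baire -> A * nat -> bool) : PR D ->
  exists2 e : A -> nat, PR (fun _ => e) &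
    forall a, halts (nth_machine (e a)) zeros <-> exists n, D zeros (a, n).
Proof.
move=> [g hg gE].
(* The search machine supplies the parameter plus one, which the predecessor undoes. *)
have [t tE] : df (fun p e => g p (consc (nth 0 e 1).-1 (consc (nth 0 e 0) 0))).
  apply: df_comp1 hg _; apply: df_comp2 fn2_consc _ _.
    exact: df_comp1 prn_pred (df_var 1).
  by apply: df_comp2 fn2_consc _ _; [exact: df_var | exact: df_const].
exists (fun a => pickle (param_machine t (pickle a))).
  apply: PR_pickle; apply: PR_comp (PR_param_machine t) _.
  exact: PR_pickle (PR_id A).
move=> a; rewrite /nth_machine pickleK /= halts_param.
have E n : (ev zeros [:: n; (pickle a).+1] t != 0) = D zeros (a, n).
  rewrite tE /=; have := gE zeros (a, n); rewrite pickle_pair => ->.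
  by rewrite pickle_bool; case: (D _ _).
by split=> -[n hn]; exists n; rewrite ?E // -E.
Qed.

Lemma PR_computable_search (b : baire -> nat * nat -> nat) (F : baire -> option baire) :
  PR b ->
  (forall p q, F p = Some q -> forall j, exists n,
     b p (j, n) = (unary q j).+1 /\ forall m, m < n -> b p (j, m) = 0) ->
  computable F.
Proof.
move=> [g hg gE] H.
have [t tE] : df (fun p e => g p (consc (nth 0 e 1) (consc (nth 0 e 0) 0))).
  apply: df_comp1 hg _; apply: df_comp2 fn2_consc _ _; first exact: df_var.
  by apply: df_comp2 fn2_consc _ _; [exact: df_var | exact: df_const].
have E p n j : ev p [:: n; j] t = b p (j, n).
  by rewrite tE /=; apply: (gE p (j, n)).
apply: (@computable_bits t) => p q /H{}H j; have [n [n1 n2]] := H j.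
by exists n; rewrite E; split=> // m; rewrite E; apply: n2.
Qed.

Lemma PR_limit_computable (b : baire -> nat * nat -> bool) (F : baire -> option baire) :
  PR b ->
  (forall p q, F p = Some q -> forall j, exists N, forall n, N <= n ->
     b p (j, n) = unary q j) ->
  limit_computable F.
Proof.
move=> [g hg gE] H.
have [t tE] : df (fun p e => g p (consc (nth 0 e 0) (consc (nth 0 e 1) 0))).
  apply: df_comp1 hg _; apply: df_comp2 fn2_consc _ _; first exact: df_var.
  by apply: df_comp2 fn2_consc _ _; [exact: df_var | exact: df_const].
have E p n j : (ev p [:: j; n] t != 0) = b p (j, n).
  rewrite tE /=; have := gE p (j, n); rewrite pickle_pair => ->.
  by rewrite pickle_bool; case: (b p _).
apply: (@limit_computable_bits t) => p q /H{}H j; have [N hN] := H j.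
by exists N => n /hN; rewrite E.
Qed.

Lemma PR_computable (f : baire -> nat -> nat) :
  PR f -> computable (fun p => Some (f p : baire)).
Proof.
move=> hf; apply: (@PR_computable_search (fun p x => (unary (f p) x.1).+1)).
  apply: PR_succ; apply: PR_nat_of_bool.
  apply: (PR_unary (x := fun p y => f p y.2)); last by pr.
  by apply: (PR_comp hf); pr.
by move=> p q [<-] j; exists 0.
Qed.

(** * Approximate computations *)

Lemma unary_agree (x y : baire) j : (forall i, i <= j -> x i = y i) ->
  unary x j = unary y j.
Proof.
move=> xy; rewrite /unary; congr (nth _ (flatten _) _).
by apply/eq_in_map => i; rewrite mem_iota add0n ltnS => /= /xy ->.
Qed.

(** Within [T] steps the input head stays within distance [T] of the origin, and the symbol in cell
    [j] depends only on the values up to index [j]. *)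
Lemma run_agree k (prog : seq (instr k)) (x y : baire) T :
  (forall i, i <= T -> x i = y i) ->
  tapes (run prog x T) = tapes (run prog y T).
Proof.
move=> xy.
pose same t (c c' : config k) := [/\ state c = state c',
  head (input c) = head (input c') /\ `|head (input c)|%N <= t,
  tapes c = tapes c', cells (input c) = cells (input_tape x) &
  cells (input c') = cells (input_tape y)].
suff main t : t <= T -> same t (run prog x t) (run prog y t).
  by case: (main T (leqnn T)).
elim: t => [_|t IH tT]; first by [].
have [E1 [E2 E2'] E3 E4 E5] := IH (ltnW tT).
rewrite /run !iterS -!/(run _ _ _).
set c := run prog x t in E1 E2 E2' E3 E4 *; set c' := run prog y t in E1 E2 E3 E5 *.
have Er : read (input c) = read (input c').
  rewrite /read E4 E5 -E2 /=; case: (head _) E2' => //= n nt; congr Some.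
  by apply: unary_agree => i le; apply: xy; apply: leq_trans le (leq_trans nt (ltnW tT)).
have Es : scanned c = scanned c' by apply: scanned_eq => // i; rewrite E3.
rewrite /step -E1 -Es; case: (ohead _) => [a|] /=.
  split=> //=; rewrite -?E2 ?E3 //; split=> //.
  by case: (a.1.2); rewrite /shift; lia.
by split=> //; split=> //; exact: leqW.
Qed.

(** * One-way output is never revised *)

Section OneWay.
Variables (M : machine) (x : baire).
Hypothesis ow : one_way M.
Let out t := output (run (tagged M) x t).

Lemma one_way_next t :
  (forall z, z != head (out t) -> cells (out t.+1) z = cells (out t) z) /\
  (head (out t.+1) = (head (out t) + 1)%R \/
   head (out t.+1) = head (out t) /\ cells (out t.+1) = cells (out t)).
Proof.
rewrite /out /run iterS -/(run _ _ _); set c := run _ _ _.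
rewrite /step; set s := [seq e <- _ | _].
have: all (fun e => (e \in tagged M) && (e.1 == (state c, scanned c))) s.
  by apply/allP => e; rewrite mem_filter andbC.
case: s => [|e s] /=; first by split=> //; right.
move=> /andP[/andP[eM /eqP ee] _].
have := allP ow e eM; rewrite ee /= !thead_tnth.
have -> : tnth (scanned c) (inord 1) = read (output c).
  rewrite (tnth_nth None) inordK //; exact: (@scanned_tapes _ c ord0).
set c1 := Config _ _ _.
have -> : output c1 = act (tnth e.2.2 ord0) (output c).
  by rewrite /output !thead_tnth tnth_mktuple.
case: (tnth e.2.2 ord0) => a d /= /orP[/eqP ->|/andP[/eqP -> /eqP ->]].
  by split; [move=> z /negPf -> | left].
split; first by move=> z /negPf ->.
by right; split=> //; apply/funext => z; case: eqP => [->|].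
Qed.

(** Cells are altered only when the head leaves them to the right, so everything from the head on is
    still blank. *)
Lemma one_way_head t : exists2 h, head (out t) = Posz h &
  forall z, h <= z -> cells (out t) (Posz z) = None.
Proof.
elim: t => [|t [h hh hb]].
  by exists 0; rewrite /out /output thead_tnth tnth_mktuple.
have [Hc [Eh|[Eh Ec]]] := one_way_next t; last by exists h; rewrite ?Eh ?Ec.
exists h.+1; first by rewrite Eh hh; lia.
by move=> z hz; rewrite Hc ?hb ?(ltnW hz) // hh; apply/eqP; lia.
Qed.

Lemma one_way_left t t' z : t <= t' -> (z < head (out t))%R ->
  cells (out t') z = cells (out t) z.
Proof.
move=> /subnK <- zh; suff : (z < head (out (t' - t + t)))%R /\
  cells (out (t' - t + t)) z = cells (out t) z by case.
elim: (t' - t) => [|n [IH1 IH2]]; first by rewrite add0n.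
have [Hc Hh] := one_way_next (n + t); rewrite addSn; split.
  by case: Hh => [->|[-> _]] //; lia.
by rewrite Hc // lt_eqF.
Qed.

(** A cell that is not blank lies to the left of the head, where nothing changes any more. *)
Lemma one_way_written t t' z b : t <= t' -> cells (out t) (Posz z) = Some b ->
  cells (out t') (Posz z) = Some b.
Proof.
move=> tt zb; rewrite -zb; apply: one_way_left tt _.
have [h -> hb] := one_way_head t; rewrite ltz_nat ltnNge; apply/negP => /hb.
by rewrite zb.
Qed.

Hypothesis (q : baire) (Mq : produces M x q).

(** The head has passed all cells up to a written one, so their contents are final and agree with
    the limit. *)
Lemma produces_prefix t z z' : z' <= z -> isSome (cells (out t) (Posz z)) ->
  cells (out t) (Posz z') = Some (unary q z').
Proof.
move=> zz; case E: (cells _ _) => [b|] // _.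
have [N _ HN] := Mq z'.
have := HN (maxn N t) (leq_maxl _ _); rewrite /= -/(out _) => <-.
apply/esym/one_way_left; first exact: leq_maxr.
have [h -> hb] := one_way_head t; rewrite ltz_nat (leq_ltn_trans zz) //.
by rewrite ltnNge; apply/negP => /hb; rewrite E.
Qed.

End OneWay.

(* Block [k] ends at the zero that is preceded by [k] zeros. *)
Definition zeros_before (c : nat -> symbol) (n : nat) : nat :=
  iteri n (fun z acc => acc + (c z == Some false)) 0.

Definition decode_block (c : nat -> symbol) (n k : nat) : nat :=
  iteri n (fun z acc => acc + ((c z == Some true) && (zeros_before c z == k))) 0.

Section DecodeBlock.
Variables (c : nat -> symbol) (q : baire).

Lemma zeros_before_unary n m : m <= q n ->
  (forall z, z < pos q n + m -> c z = Some (unary q z)) ->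
  zeros_before c (pos q n + m) = n.
Proof.
elim: n m => [|n IH] m mn H.
  elim: m mn H => [_ _|m IHm mn H]; first by rewrite /pos big_ord0.
  rewrite addnS /= -/(zeros_before c _).
  rewrite IHm ?(ltnW mn) // => [|z hz]; last by rewrite H // addnS ltnS ltnW.
  by rewrite H ?addnS // unary_pos ?(ltnW mn) // mn.
elim: m mn H => [_ H|m IHm mn H].
  rewrite addn0 posS addnS /= -/(zeros_before c _) IH //.
    rewrite H; last by rewrite addn0 posS addnS.
    by rewrite unary_pos // ltnn addn1.
  by move=> z hz; rewrite H // addn0 posS addnS ltnW.
rewrite addnS /= -/(zeros_before c _) IHm ?(ltnW mn) // => [|z hz]; last first.
  by rewrite H // addnS ltnS ltnW.
by rewrite H ?addnS // unary_pos ?(ltnW mn) // mn addn0.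
Qed.

Lemma zeros_before_mono m n : m <= n -> zeros_before c m <= zeros_before c n.
Proof.
move=> /subnK <-; elim: (n - m) => // d IH.
by rewrite addSn (leq_trans IH) //= leq_addr.
Qed.

(** The counted ones are those preceded by exactly [k] zeros: there are none before block [k], one
    in each of its first [q k] cells, and none after it. Thus [c] may be arbitrary beyond block
    [k]. *)
Lemma decode_blockE k n : pos q k.+1 <= n ->
  (forall z, z < pos q k.+1 -> c z = Some (unary q z)) ->
  decode_block c n k = q k.
Proof.
move=> kn H.
have H0 n' : n' <= pos q k -> decode_block c n' k = 0.
  elim: n' => // n' IH n'k; rewrite /decode_block /= -/(decode_block c _ _) IH 1?ltnW //.
  have [i [m [E mi]]] := pos_split q n'.
  have ik : i < k.
    rewrite ltnNge; apply/negP => /(pos_leq q); rewrite leqNgt.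
    by rewrite (leq_ltn_trans _ n'k) // E leq_addr.
  rewrite E zeros_before_unary // ?(ltn_eqF ik) ?andbF // => z hz.
  by rewrite H // posS (ltn_trans hz) // -E (leq_trans n'k) // leq_addr.
have H1 m : m <= q k -> decode_block c (pos q k + m) k = m.
  elim: m => [|m IH] mk; first by rewrite addn0 H0.
  rewrite addnS /decode_block /= -/(decode_block c _ _) IH 1?ltnW //.
  rewrite zeros_before_unary ?(ltnW mk) // => [|z hz]; last first.
    by rewrite H // posS (ltn_trans hz) // ltn_add2l ltnS ltnW.
  rewrite H ?posS ?ltn_add2l ?ltnS ?(ltnW mk) //.
  by rewrite unary_pos ?(ltnW mk) // mk !eqxx addn1.
rewrite -(subnK kn); elim: (n - _) => [|d IH].
  rewrite add0n posS addnS /decode_block /= -/(decode_block c _ _) H1 //.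
  by rewrite H ?posS ?addnS // unary_pos // ltnn addn0.
rewrite addSn /decode_block /= -/(decode_block c _ _) IH.
rewrite gtn_eqF ?andbF ?addn0 //.
apply: (@leq_trans (zeros_before c (pos q k.+1))); last first.
  by apply: zeros_before_mono; rewrite leq_addl.
have := @zeros_before_unary k.+1 0 (leq0n _).
by rewrite addn0 => ->.
Qed.

(** More than [k] zeros show that block [k] has been written completely. This gives a decidable test
    for whether a decoded value is final. *)
Lemma zeros_before_gt k n : k < zeros_before c n ->
  (forall z z', z' <= z -> isSome (c z) -> c z' = Some (unary q z')) ->
  pos q k.+1 <= n /\ forall z, z < pos q k.+1 -> c z = Some (unary q z).
Proof.
move=> kn H.
elim: n kn => // n IH; rewrite /zeros_before /= -/(zeros_before c n).
case: eqP => [En|_]; last by rewrite addn0 => /IH[h1 h2]; split=> //; exact: leqW.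
rewrite addn1 ltnS leq_eqVlt => /orP[/eqP kE|/IH[h1 h2]]; last first.
  by split=> //; exact: leqW.
have Hn z : z <= n -> c z = Some (unary q z) by move=> zn; apply: (H n) => //; rewrite En.
have [i [m [E mi]]] := pos_split q n.
have iE : k = i.
  by rewrite kE E zeros_before_unary // => z hz; rewrite Hn // E ltnW.
have mE : m = q i.
  have := Hn n (leqnn n); rewrite En E unary_pos // => -[] /esym/negbT.
  by rewrite -leqNgt => h; apply/eqP; rewrite eqn_leq mi.
have pE : pos q k.+1 = n.+1 by rewrite posS iE E mE addnS.
by rewrite pE; split=> // z; rewrite ltnS; apply: Hn.
Qed.

End DecodeBlock.

Lemma PR_zeros_before (A : countType) (c : baire -> A * nat -> symbol) (n : baire -> A -> nat) :
  PR c -> PR n -> PR (fun p a => zeros_before (fun z => c p (a, z)) (n p a)).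
Proof. by move=> hc hn; rewrite /zeros_before; pr. Qed.

Lemma PR_decode_block (A : countType) (c : baire -> A * nat -> symbol)
    (n k : baire -> A -> nat) :
  PR c -> PR n -> PR k ->
  PR (fun p a => decode_block (fun z => c p (a, z)) (n p a) (k p a)).
Proof.
move=> hc hn hk; rewrite /decode_block; pr.
by apply: (PR_zeros_before (c := fun p y => c p (y.1.1, y.2))); pr.
Qed.

Lemma eventually_forall (P : nat -> nat -> Prop) :
  (forall j, exists N, forall n, N <= n -> P j n) ->
  forall b, exists N, forall n, N <= n -> forall j, j < b -> P j n.
Proof.
move=> H; elim=> [|b [N HN]]; first by exists 0.
have [N' HN'] := H b; exists (maxn N N') => n; rewrite geq_max => /andP[h1 h2] j.
by rewrite ltnS leq_eqVlt => /orP[/eqP ->|]; [exact: HN' | exact: HN].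
Qed.

Definition converges (x_ : nat -> baire) (x : baire) : Prop :=
  forall i, exists N, forall n, N <= n -> x_ n i = x i.

(* A symbol is written after reading finitely many values of [x], on which [x_ n]
   agrees with [x] for large [n], and it is never revised. *)
Lemma converges_output M (x_ : nat -> baire) x q : one_way M -> produces M x q ->
  converges x_ x -> forall j, exists N, forall n, N <= n ->
    cells (output (run (tagged M) (x_ n) n)) (Posz j) = Some (unary q j).
Proof.
move=> ow Mq xx j; have [T _ HT] := Mq j.
have [N HN] := eventually_forall xx T.+1.
exists (maxn N T) => n; rewrite geq_max => /andP[Nn Tn].
apply: (one_way_written ow Tn).
rewrite /output (@run_agree _ (tagged M) _ x) => [|i iT]; last exact: HN.
exact: (HT T (leqnn T)).
Qed.

(** Once [n] exceeds the end of block [k] and all the symbols up to there have been written, the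
    decoded value is correct. *)
Lemma converges_decode M (x_ : nat -> baire) x q : one_way M -> produces M x q ->
  converges x_ x -> converges (fun n k => decode_block
    (fun z => cells (output (run (tagged M) (x_ n) n)) (Posz z)) n k) q.
Proof.
move=> ow Mq xx k; have [N HN] := eventually_forall (converges_output ow Mq xx) (pos q k.+1).
exists (maxn N (pos q k.+1)) => n; rewrite geq_max => /andP[Nn kn].
by rewrite (@decode_blockE _ q) // => z; apply: HN.
Qed.

(** The inverse of the Cantor pairing, by a search bounded by the code itself, which keeps it
    primitive recursive. *)
Definition cfst (n : nat) : nat := iteri n.+1 (fun i acc =>
  if iteri n.+1 (fun k b => b || (cantor_pair i k == n)) false then i else acc) 0.

Definition csnd (n : nat) : nat := iteri n.+1 (fun k acc =>
  if iteri n.+1 (fun i b => b || (cantor_pair i k == n)) false then k else acc) 0.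

Lemma iteri_find (P : nat -> bool) n m :
  m < n -> P m -> (forall i, P i -> i = m) ->
  iteri n (fun i acc => if P i then i else acc) 0 = m.
Proof.
move=> mn Pm Pi; elim: n mn => // n IH; rewrite ltnS leq_eqVlt /=.
by case: ifP => [/Pi -> //|Pn] /orP[/eqP mE|/IH //]; rewrite mE Pn in Pm.
Qed.

Lemma leq_cantor i k : i <= cantor_pair i k /\ k <= cantor_pair i k.
Proof.
rewrite /cantor_pair; split; last exact: leq_addl.
have main s : s <= (s * s.+1)./2.
  case: s => // s; rewrite -[X in X <= _]doubleK; apply: half_leq.
  by rewrite -muln2 leq_mul.
rewrite (leq_trans (leq_addr k i)) // (leq_trans (main _)) //.
exact: leq_addr.
Qed.

Lemma cfstK i k : cfst (cantor_pair i k) = i.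
Proof.
have [h1 h2] := leq_cantor i k; apply: iteri_find; first by rewrite ltnS.
  by rewrite iteri_or; apply/existsP; exists (Ordinal (h2 : k < (cantor_pair i k).+1)).
by move=> j; rewrite iteri_or => /existsP[k' /eqP /cantor_pair_inj[]].
Qed.

Lemma csndK i k : csnd (cantor_pair i k) = k.
Proof.
have [h1 h2] := leq_cantor i k; apply: iteri_find; first by rewrite ltnS.
  by rewrite iteri_or; apply/existsP; exists (Ordinal (h1 : i < (cantor_pair i k).+1)).
by move=> j; rewrite iteri_or => /existsP[k' /eqP /cantor_pair_inj[]].
Qed.

Section PRPairing.
Variable A : countType.

Lemma PR_cantor_pair (f g : baire -> A -> nat) :
  PR f -> PR g -> PR (fun p a => cantor_pair (f p a) (g p a)).
Proof. by move=> hf hg; rewrite /cantor_pair; pr. Qed.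
End PRPairing.

Ltac pr_ext ::= lazymatch goal with
  | |- @PR _ _ ?F => lazymatch F with
    | fun p a => cantor_pair (@?t p a) (@?u p a) => apply: PR_cantor_pair
    end
  end.

Lemma PR_cfst (A : countType) (f : baire -> A -> nat) : PR f -> PR (fun p a => cfst (f p a)).
Proof. by move=> hf; rewrite /cfst; pr. Qed.

Lemma PR_csnd (A : countType) (f : baire -> A -> nat) : PR f -> PR (fun p a => csnd (f p a)).
Proof. by move=> hf; rewrite /csnd; pr. Qed.

(** * Limits and function spaces *)

Local Open Scope classical_set_scope.

Lemma nbhs_coord (q : baire) (k : nat) : nbhs q [set r : baire | r k = q k].
Proof. exact: (@proj_continuous nat (fun=> nat) k q [set q k] (discrete_set1 (q k))). Qed.

(** The product topology is the supremum of the topologies induced by the coordinates, and the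
    factors are discrete. *)
Lemma cvg_baire (f : nat -> baire) (q : baire) :
  f @ \oo --> q <-> converges f q.
Proof.
split=> [fq k|fq].
  have /fq [N _ HN] := nbhs_coord q k.
  by exists N => n Nn; apply: HN.
apply/cvg_sup => k U [V] [[W] oW <-] Wq WU.
apply: (filterS WU); have [N HN] := fq k.
by exists N => // n /= /HN E; rewrite /= E.
Qed.

Lemma blim_converges p q : blim p = Some q <-> converges (bcol p) q.
Proof. by split=> [/blimP/cvg_baire|/cvg_baire/blimP]. Qed.

(** A choice of names for all values gives a realizer that depends on [s 0] only and so is locally
    constant. Hence both function spaces consist of all functions on the natural numbers. *)
Lemma realizer_on_nat (Y : repspace) (f : nat_space -> Y) :
  has_realizer pcontinuous f.
Proof.
have [name nameP] := choice (fun n => rep_surj (f n)).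
exists (fun s => Some (name (s 0))); last first.
  by move=> s n [<-] /=; exact: nameP.
apply: continuous_subspaceT => s; apply: cvg_near_cst.
by apply: filterS (nbhs_coord s 0) => s' /= ->.
Qed.

Lemma C_carrier_eq (X Y : repspace) (f g : C_carrier X Y) : sval f = sval g -> f = g.
Proof.
case: f g => f hf [g hg] /= fg.
by move: hf hg; rewrite fg => hf hg; congr exist; exact: Prop_irrelevance.
Qed.

Lemma bpair_even p q n : bpair p q (n + n) = p n.
Proof. by rewrite /bpair addnn odd_double doubleK. Qed.

Lemma bpair_odd p q n : bpair p q (n + n).+1 = q n.
Proof. by rewrite /bpair addnn /= odd_double /= uphalf_double. Qed.

Definition approximate (M : machine) (x_ : nat -> baire) (n : nat) : baire :=
  decode_block (fun z => cells (output (run (tagged M) (x_ n) n)) (Posz z)) n.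

Lemma PR_approximate (A : countType) (M : machine) (x : baire -> A * nat -> nat)
    (n k : baire -> A -> nat) : PR x -> PR n -> PR k ->
  PR (fun p a => decode_block (fun z =>
    cells (output (run (tagged M) (fun l => x p (a, l)) (n p a))) (Posz z)) (n p a) (k p a)).
Proof.
move=> hx hn hk.
apply: (PR_decode_block (c := fun p y => cells (output (run (tagged M)
    (fun l => x p (y.1, l)) (n p y.1))) (Posz y.2))) => //.
by apply: (PR_output M (x := fun p y => x p (y.1.1, y.2))); pr.
Qed.

Lemma converges_cst x : converges (fun=> x) x.
Proof. by exists 0. Qed.

(** The iteration returns the value at the last index that satisfies [P]; this index is at least
    [N]. *)
Lemma iteri_last (P : nat -> bool) (v : nat -> nat) (n N a : nat) :
  N < n -> P N -> (forall i, N <= i -> P i -> v i = a) ->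
  iteri n (fun i acc => if P i then v i else acc) 0 = a.
Proof.
move=> Nn PN Pv; elim: n Nn => // n IH; rewrite ltnS leq_eqVlt /=.
case/orP => [/eqP <-|Nn]; first by rewrite PN Pv.
by case: ifP => [/Pv -> //|_]; [exact: ltnW | exact: IH].
Qed.

(** * From a limit of codes to a code of a function into the jump *)

Section FromLimit.
Variable M : machine.

(** For [x = <p, s>] this is [<p_i, s>]. *)
Definition from_limit_input (x : baire) (i : nat) : baire := fun l =>
  if odd l then x (l./2 + l./2).+1
  else let c := cantor_pair i l./2 in x (c + c).

Definition from_limit (x : baire) : baire := fun n =>
  approximate M (from_limit_input x) (cfst n) (csnd n).

Lemma PR_from_limit : PR from_limit.
Proof.
apply: (PR_approximate M (x := fun p y => from_limit_input p (cfst y.1) y.2)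
  (n := fun _ => cfst) (k := fun _ => csnd)).
- have h : PR (fun _ (y : nat * nat) => cfst y.1) by apply: PR_cfst; pr.
  by rewrite /from_limit_input; pr; apply: h.
- by apply: PR_cfst; pr.
- by apply: PR_csnd; pr.
Qed.

Lemma from_limitP p q s w : one_way M -> produces M (bpair q s) w ->
  blim p = Some q -> blim (from_limit (bpair p s)) = Some w.
Proof.
move=> ow Mw /blim_converges pq; apply/blim_converges.
have h : converges (from_limit_input (bpair p s)) (bpair q s).
  move=> l; rewrite /from_limit_input [bpair q s l]/bpair; case: ifP => lo.
    by exists 0 => n _; rewrite bpair_odd.
  by have [N HN] := pq l./2; exists N => n /HN <-; rewrite /= bpair_even.
move=> k; have [N HN] := converges_decode ow Mw h k.
by exists N => n /HN <-; rewrite /bcol /from_limit cfstK csndK.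
Qed.

End FromLimit.

Definition const_name (n : nat) : baire := fun l => if l == 0 then n else 0.

(** * From a code of a function into the jump to a limit of codes *)

Section ToLimit.
Variables (M M' : machine).

Definition to_limit_input (r : baire) (i : nat) : baire := bpair r (const_name i).

Definition to_limit_output (r : baire) (m i z : nat) : symbol :=
  cells (output (run (tagged M) (to_limit_input r i) m)) (Posz z).

(* The [m]-th approximation to the columns [lim_i t_n(i, k)], where [t_n] is the
   output on the name of [n]: the last column that is written after [m] steps. *)
Definition last_column (r : baire) (m : nat) : baire := fun l =>
  iteri m (fun i v =>
    let c := to_limit_output r m (cfst l) in
    let b := cantor_pair i (csnd l) in
    if b < zeros_before c m then decode_block c m b else v) 0.

Definition to_limit (r : baire) : baire := fun n =>
  approximate M' (last_column r) (cfst n) (csnd n).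

Lemma PR_last_column : PR (fun r x => last_column r x.1 x.2).
Proof.
rewrite /last_column.
apply: PR_iteri; [by pr | by pr |].
have hl : PR (fun _ (y : (nat * nat) * (nat * nat)) => csnd y.1.2).
  by apply: PR_csnd; pr.
have hb : PR (fun _ (y : (nat * nat) * (nat * nat)) => cantor_pair y.2.1 (csnd y.1.2)).
  by pr.
have hc : PR (fun r (y : ((nat * nat) * (nat * nat)) * nat) =>
    to_limit_output r y.1.1.1 (cfst y.1.1.2) y.2).
  apply: (PR_output M (x := fun r y => to_limit_input r (cfst y.1.1.1.2) y.2)); [|by pr|by pr].
  rewrite /to_limit_input /bpair /const_name; pr.
  by apply: PR_cfst; pr.
apply: PR_if; [apply: PR_leq; first by pr| |by pr].
  by apply: (PR_zeros_before hc); pr.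
by apply: (PR_decode_block hc); pr.
Qed.

Lemma PR_to_limit : PR to_limit.
Proof.
apply: (PR_approximate M' (x := fun r y => last_column r (cfst y.1) y.2)
  (n := fun _ => cfst) (k := fun _ => csnd)).
- apply: (PR_comp PR_last_column (f := fun _ y => (cfst y.1, y.2))).
  by apply: PR_pair; [apply: PR_cfst; pr | pr].
- by apply: PR_cfst; pr.
- by apply: PR_csnd; pr.
Qed.

Variables (r : baire) (t w : nat -> baire).
Hypotheses (ow : one_way M).
Hypothesis Mt : forall i, produces M (to_limit_input r i) (t i).
Hypothesis tw : forall i, blim (t i) = Some (w i).

Definition limit_columns : baire := fun l => w (cfst l) (csnd l).

Lemma last_column_converges : converges (last_column r) limit_columns.
Proof.
move=> l; set i := cfst l; set k := csnd l.
have [N HN] := iffLR (blim_converges _ _) (tw i) k.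
(* A block that passes the test is complete, and one-way output makes it final. *)
have done_ok m b : b < zeros_before (to_limit_output r m i) m ->
    decode_block (to_limit_output r m i) m b = t i b.
  move=> hb; have [h1 h2] := zeros_before_gt hb (fun z z' => 
    @produces_prefix _ _ ow _ (Mt i) m z z').
  exact: decode_blockE.
(* The place of entry [k] of column [N] in [t i]; from this column on, entry [k] has its limit
   value. *)
set b0 := cantor_pair N k.
have [N1 HN1] := eventually_forall (converges_output ow (Mt i) (@converges_cst _))
  (pos (t i) b0.+1).
(* The three bounds ensure that block [b0] has been written, that column [N] is among the columns
   tried, and that the cells inspected include block [b0]. *)
exists (maxn N1 (maxn N.+1 (pos (t i) b0.+1))) => m; rewrite !geq_max => /and3P[h1 h2 h3].
apply: (@iteri_last _ (decode_block _ m \o cantor_pair^~ k) _ N) => //.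
  apply: (@leq_trans (zeros_before (to_limit_output r m i) (pos (t i) b0.+1))).
    rewrite -[pos _ _]addn0 (@zeros_before_unary _ (t i)) // => z; rewrite addn0.
    exact: HN1.
  exact: zeros_before_mono.
move=> j Nj /= hj; rewrite done_ok //.
by have := HN j Nj; rewrite /bcol => ->.
Qed.

Lemma limit_columns_name i : (fun k => limit_columns (cantor_pair i k)) = w i.
Proof. by apply/funext => k; rewrite /limit_columns cfstK csndK. Qed.

Lemma to_limitP v : one_way M' -> produces M' limit_columns v ->
  blim (to_limit r) = Some v.
Proof.
move=> ow' M'v; apply/blim_converges => k.
have [N HN] := converges_decode ow' M'v last_column_converges k.
by exists N => n /HN <-; rewrite /bcol /to_limit cfstK csndK.
Qed.

End ToLimit.

(** For [x = <y, s>] this is [y_{s 0}], since [x 1 = s 0]. *)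
Definition select_column (x : baire) : baire := fun k =>
  let c := cantor_pair (x 1) k in x (c + c).

Lemma PR_select_column : PR select_column.
Proof. by rewrite /select_column; pr. Qed.

(** * Limit computability versus computability relative to the halting problem *)

Lemma limit_computable_from_halting (X : repspace) (f : nat_space -> X) :
  has_realizer limit_computable f -> has_realizer (computable_from halting) f.
Proof.
case=> F [M MF] Ff.
pose out n t j := cells (output (run (tagged M) (const_name n) t)) (Posz j).
have hout : PR (fun _ (a : nat * (nat * nat)) => out a.1 a.2.1 a.2.2).
  apply: (PR_output M (x := fun _ y => const_name y.1.1 y.2)); [|by pr|by pr].
  by rewrite /const_name; pr.
(* For [((n, (j, t)), d)]: on the name of [n], output cell [j] differs between the times [t] and
   [t + d]. *)
pose D (_ : baire) (a : (nat * (nat * nat)) * nat) :=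
  out a.1.1 (a.1.2.2 + a.2) a.1.2.1 != out a.1.1 a.1.2.2 a.1.2.1.
have [|e he eP] := @search_index _ D.
  rewrite /D; apply: PR_not; apply: PR_eq.
    by apply: (PR_comp hout (f := fun _ a => (a.1.1, (a.1.2.2 + a.2, a.1.2.1)))); pr.
  by apply: (PR_comp hout (f := fun _ a => (a.1.1, (a.1.2.2, a.1.2.1)))); pr.
(* For [x = <0', p>] the entry at [e + e] answers halting question [e], and [x 1 = p 0] is the
   argument. The value 0 means that cell [j] still changes after time [t]; otherwise the value is
   its bit plus one. *)
pose b (x : baire) (a : nat * nat) :=
  if x (e (x 1, a) + e (x 1, a)) == 0 then (out (x 1) a.2 a.1 == Some true).+1 else 0.
(* Restricting the domain to pairs with the true halting problem limits the correctness proof to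
   these inputs. *)
pose G (x : baire) : option baire :=
  if `[< forall n, x (n + n) = halting n >] then F (const_name (x 1)) else None.
exists (fun p => F (const_name (p 0))); last first.
  by move=> p n [<-]; exact: (Ff (const_name (p 0)) (p 0) erefl).
exists G; last first.
  move=> p _; rewrite /G asboolT; first by rewrite (bpair_odd halting p 0).
  by move=> n; rewrite bpair_even.
apply: (@PR_computable_search b).
  have hex : PR (fun (x : baire) (a : nat * nat) => e (x 1, a)).
    by apply: (PR_comp he (f := fun x a => (x 1, a))); pr.
  rewrite /b; pr.
  by apply: (PR_comp hout (f := fun (x : baire) a => (x 1, (a.2, a.1)))); pr.
move=> x q; rewrite /G; case: asboolP => // xh /MF Mq j.
have halt0 t : (x (e (x 1, (j, t)) + e (x 1, (j, t))) == 0) =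
    ~~ `[< halts (nth_machine (e (x 1, (j, t)))) zeros >].
  by rewrite xh /halting; case: asboolP.
have [T _ HT] := Mq j.
have ex : exists t, x (e (x 1, (j, t)) + e (x 1, (j, t))) == 0.
  exists T; rewrite halt0; apply/asboolPn => /eP[n]; rewrite /D /= /out.
  by rewrite (HT T (leqnn T)) (HT (T + n) (leq_addr n T)) eqxx.
have [t xt mint] := ex_minnP ex; exists t; split; last first.
  by move=> m mt; rewrite /b ifF //; apply/negP => /mint; rewrite leqNgt mt.
rewrite /b /= xt; move: xt; rewrite halt0 => /asboolPn nh.
(* The content at time [t] is never changed later, so it equals the content at time [t + T], which
   is the correct one. *)
have -> : out (x 1) t j = Some (unary q j).
  rewrite -(HT (t + T) (leq_addl t T)); apply/esym/eqP.
  by apply/negPn/negP => hD; apply: nh; apply/eP; exists T.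
by case: (unary q j).
Qed.

Lemma computable_from_halting_limit (X : repspace) (f : nat_space -> X) :
  has_realizer (computable_from halting) f -> has_realizer limit_computable f.
Proof.
case=> F [G [M ow MG] FG] Ff; exists F => // {Ff}.
(* The sequence [<h_t, p>], where [h_t] is the approximation of the halting problem in [t] steps. *)
pose x_ (p : baire) (t : nat) : baire := fun l =>
  if odd l then p l./2 else halt_approx l./2 t.
apply: (@PR_limit_computable (fun p a =>
    cells (output (run (tagged M) (x_ p a.2) a.2)) (Posz a.1) == Some true)).
  apply: PR_eq; last by pr.
  apply: (PR_output M (x := fun p y => x_ p y.1.2 y.2)); [|by pr|by pr].
  rewrite /x_; pr.
  by apply: (PR_comp PR_halt_approx (f := fun _ y => (y.2./2, y.1.2))); pr.
move=> p q Fq j.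
have Gq : G (bpair halting p) = Some q by rewrite -FG // /dom /= Fq.
have xx : converges (x_ p) (bpair halting p).
  move=> l; rewrite /x_ /bpair; case: ifP => _; first by exists 0.
  by have [N HN] := halting_approx l./2; exists N => n /HN ->.
have [N HN] := converges_output ow (MG _ _ Gq) xx j.
by exists N => n /HN /= ->; case: (unary q j).
Qed.


Theorem corollary4p14 (Phi : baire -> baire -> option baire)
    (HPhi : standard Phi) (X : repspace) :
  (exists iota : jump (C_space HPhi nat_space X) ->
                 C_space HPhi nat_space (jump X),
     (forall f : C_space HPhi nat_space X, sval (iota f) = sval f) /\
     computable_iso iota) /\
  (forall f : nat_space -> X,
     has_realizer limit_computable f <->
     has_realizer (computable_from halting) f).
Proof.
have [U [MU owU MUP] UE] := standard_utm HPhi.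
split; last first.
  move=> f; split; first exact: limit_computable_from_halting.
  exact: computable_from_halting_limit.
(* Both maps keep the underlying function; its continuity is automatic on the natural numbers. *)
pose iota (f : C_carrier nat_space X) : C_carrier nat_space (jump X) :=
  exist _ (sval f) (realizer_on_nat (sval f : nat_space -> jump X)).
pose iota' (f : C_carrier nat_space (jump X)) : C_carrier nat_space X :=
  exist _ (sval f) (realizer_on_nat (sval f : nat_space -> X)).
exists iota; split=> //; exists iota'; split.
- by move=> f; exact: C_carrier_eq.
- by move=> f; exact: C_carrier_eq.
(* The map [<p, s> |-> <t_0, t_1, ...>] is total and computable, so the smn-theorem yields a code of
   it for each [p]. *)
- have [S cS SE] := standard_smn HPhi (PR_computable (PR_from_limit MU)).
  exists (fun p => Some (S p)) => // p f /=; rewrite /jump_rep.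
  case pq : (blim p) => [q|] //= /C_repP qf; apply/C_repP => s n sn.
  rewrite SE //=; have := qf s n sn; case E : (Phi q s) => [v|] //= vX.
  rewrite /jump_rep (@from_limitP MU p q s v) //.
  by apply: MUP; rewrite UE.
(* [S y] is a code of the function with the names [y_0, y_1, ...]. Since [y] is known only as a
   limit, the machine [MS] for [S] is itself run on approximations. *)
have [S [MS owS MSP] SE] := standard_smn HPhi (PR_computable PR_select_column).
exists (fun r => Some (to_limit MU MS r)); first exact: (PR_computable (PR_to_limit MU MS)).
move=> r f /= /C_repP rf.
have ex n : exists tw : baire * baire, [/\ Phi r (const_name n) = Some tw.1,
    blim tw.1 = Some tw.2 & rep X tw.2 = Some (sval f n)].
  have := rf (const_name n) n erefl; case E : (Phi _ _) => [t|] //=.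
  by rewrite /jump_rep; case tw : (blim t) => [w|] //= wX; exists (t, w).
(* For each [n], the pair of the name of [f n] in the jump that [Phi r] yields, and of the limit of
   its columns. *)
have [tw twP] := choice ex.
have Mt n : produces MU (to_limit_input r n) (tw n).1.
  by apply: MUP; rewrite UE; have [] := twP n.
have tw_lim n : blim (tw n).1 = Some (tw n).2 by have [] := twP n.
rewrite /jump_rep (to_limitP owU Mt tw_lim owS (MSP _ _ erefl)) /=.
apply/C_repP => s n [<-]; rewrite SE //=.
have -> : select_column (bpair (limit_columns (fun n => (tw n).2)) s) = (tw (s 0)).2.
  rewrite -[RHS](limit_columns_name (fun n => (tw n).2)); apply/funext => k.
  by rewrite /select_column (bpair_odd _ s 0) bpair_even.
by have [] := twP (s 0).
Qed.
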